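(* Let $(X,\mathcal A,\mu,T)$ be an invertible probability measure preserving system (on a standard probability space) and let $v(x)=\sum_{j=1}^\ell a_jx^{2j-1}$ be an odd polynomial with $v(\mathbb{Z})\subseteq\mathbb{Z}$. For every $A\in\mathcal A$ and every $\epsilon>0$, the set $$\mathcal R_A(v,\epsilon)=\{n\in\mathbb{N}:\mu(A\cap T^{-v(n)}A)>\mu^2(A)-\epsilon\}$$ is A-$\Delta_{\ell,0}^*$.
   Context: $\mathbb{N}=\{1,2,\dots\}$. The upper Banach density of $E\subseteq\mathbb{N}$ is $d^*(E)=\limsup_{N-M\to\infty}\frac{|E\cap\{M+1,\dots,N\}|}{N-M}$. Define $\partial:\bigcup_{\ell\ge1}\mathbb{Z}^{2^\ell}\to\mathbb{Z}$ recursively by $\partial(m_1,m_2)=m_2-m_1$ and $\partial(m_1,\dots,m_{2^\ell})=\partial(m_{2^{\ell-1}+1},\dots,m_{2^\ell})-\partial(m_1,\dots,m_{2^{\ell-1}})$ for $\ell>1$. For an $r$-element sequence $(n_k)_{k=1}^r$ in $\mathbb{Z}$, $D_\ell((n_k)_{k=1}^r)=\{\partial(n_{j_1},\dots,n_{j_{2^\ell}}):1\le j_1<\dots<j_{2^\ell}\le r\}$. For $r\ge2^\ell$, $E\subseteq\mathbb{N}$ is a $\Delta_{\ell,r}$ set if $D_\ell((n_k)_{k=1}^r)\subseteq E$ for some $r$-element sequence in $\mathbb{Z}$; $E$ is a $\Delta_{\ell,0}$ set if it contains a $\Delta_{\ell,r}$ set for every $r\ge 2^\ell$; $E$ is $\Delta_{\ell,0}^*$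 if it meets every $\Delta_{\ell,0}$ set. A set $D\subseteq\mathbb{N}$ is A-$\Delta_{\ell,0}^*$ if there exists $E\subseteq\mathbb{N}$ with $d^*(E)=0$ such that $D\cup E$ is $\Delta_{\ell,0}^*$. *)

(* Defs.v *)
From HB Require Import structures.
From mathcomp Require Import all_boot all_order all_algebra.
From mathcomp Require Import all_classical all_reals all_analysis.

Set Implicit Arguments.
Unset Strict Implicit.
Unset Printing Implicit Defensive.

Import Order.TTheory GRing.Theory Num.Theory.
Import numFieldNormedType.Exports.

Local Open Scope classical_set_scope.
Local Open Scope ring_scope.

(* The natural numbers of the source start at 1; its subsets of N are the
   E : set nat with E `<=` Npos. *)
Definition Npos : set nat := [set n | (0 < n)%N].

(* The family of sets {(M, N) : N - M >= L}, L in nat, is a base of the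
   filter "N - M --> oo" on pairs (M, N). *)
Definition gap_filter : set_system (nat * nat) :=
  filter_from [set: nat] (fun L => [set MN | (MN.1 + L <= MN.2)%N]).

Definition upper_banach_density (R : realType) (E : set nat) : \bar R :=
  limf_esup
    (fun MN : nat * nat =>
       ((\sum_(MN.1.+1 <= k < MN.2.+1 | k \in E) 1)%N%:R / (MN.2 - MN.1)%N%:R)%:E)
    gap_filter.

(* The recursion is started at l = 0 with partial 0 [:: m] = m, which gives
   partial 1 [:: m1; m2] = m2 - m1; only l >= 1 and size m = 2 ^ l matter. *)
Fixpoint partial (l : nat) (m : seq int) : int :=
  if l is l'.+1 then
    partial l' (drop (2 ^ l') m) - partial l' (take (2 ^ l') m)
  else head 0 m.

Definition Dset (l r : nat) (n : 'I_r -> int) : set int :=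
  [set partial l [seq n j | j <- js] |
     js in [set js : (2 ^ l).-tuple 'I_r | sorted ltn [seq val j | j <- js]]].

Definition is_Delta (l r : nat) (E : set nat) : Prop :=
  E `<=` Npos /\ exists n : 'I_r -> int, Dset l n `<=` Posz @` E.

Definition is_Delta0 (l : nat) (E : set nat) : Prop :=
  E `<=` Npos /\
  forall r : nat, (2 ^ l <= r)%N -> exists2 F, is_Delta l r F & F `<=` E.

Definition is_Delta0_star (l : nat) (E : set nat) : Prop :=
  E `<=` Npos /\ forall F, is_Delta0 l F -> E `&` F !=set0.

(* R is the real field in which the density is computed. *)
Definition is_A_Delta0_star (R : realType) (l : nat) (D : set nat) : Prop :=
  D `<=` Npos /\
  exists E : set nat,
    [/\ E `<=` Npos, upper_banach_density R E = 0%E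
      & is_Delta0_star l (D `|` E)].

(* The disjoint union of the interval [0, c] with Lebesgue measure and of
   countably many atoms of masses p 0, p 1, ..., realised on the real line with
   the k-th atom at -(k+1). *)
Definition interval_and_atoms (R : realType) (c : R) (p : nat -> R)
    (B : set (measurableTypeR R)) : \bar R :=
  (lebesgue_measure (B `&` `[0%R, c]%classic)
   + \sum_(0 <= k <oo) (p k)%:E * \d_((- k.+1%:R)%R : measurableTypeR R) B)%E.

(* (X, mu) is isomorphic mod 0 to an interval with countably many atoms: f
   restricted to the conull set X0 is injective, carries mu to the model measure
   and maps measurable sets to sets measurable for the completion of the model.
   The sigma-algebra of X itself need not be complete, so both standard Borel
   probability spaces and their completions are covered. *)
Definition standard_probability (d : measure_display) (X : measurableType d)
    (R : realType) (mu : probability X R) : Prop :=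
  exists (c : R) (p : nat -> R) (X0 : set X) (f : X -> measurableTypeR R),
    [/\ 0 <= c,
        forall k, 0 <= p k,
        measurable X0 /\ mu X0 = 1%E,
        measurable_fun [set: X] f /\ {in X0 &, injective f}
      & (forall B, measurable B -> mu (f @^-1` B) = interval_and_atoms c p B) /\
        (forall A, measurable A -> A `<=` X0 ->
           exists B, [/\ measurable B, B `<=` f @` A
             & (interval_and_atoms c p).-negligible (f @` A `\` B)])].

Record invertible_mps (d : measure_display) (X : measurableType d)
    (R : realType) (mu : probability X R) (T Tinv : X -> X) : Prop := {
  mps_standard : standard_probability mu ;
  mps_cancel : cancel T Tinv ;
  mps_cancel_inv : cancel Tinv T ;
  mps_measurable : measurable_fun [set: X] T ;
  mps_measurable_inv : measurable_fun [set: X] Tinv ;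
  mps_preserving : forall A, measurable A -> mu (T @^-1` A) = mu A }.

(* T ^ z for z : int, where Tinv is the inverse of T. *)
Definition iterz (X : Type) (T Tinv : X -> X) (z : int) : X -> X :=
  match z with
  | Posz n => iter n T
  | Negz n => iter n.+1 Tinv
  end.

Definition odd_poly_of (R : realType) (l : nat) (a : nat -> R) : {poly R} :=
  \sum_(1 <= j < l.+1) a j *: 'X^(2 * j - 1).

(* v.[n%:R] is an integer whenever v maps integers to integers, and Num.floor
   then only retypes it as an int. *)
Definition return_set (d : measure_display) (X : measurableType d)
    (R : realType) (mu : probability X R) (T Tinv : X -> X)
    (v : {poly R}) (A : set X) (eps : R) : set nat :=
  [set n | (0 < n)%N /\
    (mu A ^+ 2 - eps%:E
       < mu (A `&` iterz T Tinv (Num.floor v.[n%:R]) @^-1` A))%E].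

(* Main.v *)
Require Import Defs.
From HB Require Import structures.
From mathcomp Require Import all_boot all_order all_algebra.
From mathcomp Require Import all_classical all_reals all_analysis.
From mathcomp Require Import zify ring lra.

Set Implicit Arguments.
Unset Strict Implicit.
Unset Printing Implicit Defensive.

Import Order.TTheory GRing.Theory Num.Theory.
Import numFieldNormedType.Exports.

(** Put phi(m) = mu(A `&` T^-m A) - mu(A)^2.  This is a positive definite sequence
    on the integers, and it splits as phi = psi + chi with psi and chi positive
    definite, the translates of psi totally bounded, and chi^2 of mean zero: one
    repeatedly subtracts the autocorrelation m |-> mean_n phi(n + m) phi(n), which
    is dominated by phi and totally bounded, and passes to the limit.  This
    replaces the splitting of the spectral measure into atoms and a continuous
    part, so neither Herglotz' theorem nor the Kronecker factor is needed.

    Van der Corput's trick and induction on the degree show that chi(v(n)) tends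
    to 0 off a set E of upper Banach density 0.  On the other hand, for
    psi(0) - psi(v(n)) to be small it suffices that n lies in a set of Bohr type,
    and these are Delta_{l,0}^*: Ramsey's theorem makes the monomials in the n_i
    nearly constant, and the expansion of v(partial(n_1, ..., n_{2^l})) then
    cancels because the coefficients of partial form a Thue-Morse word.  Since
    psi(0) >= 0, phi(v(n)) > - eps for such n outside E. *)

(** * Ramsey's theorem for finite sequences *)

Section Ramsey.
Variable X : eqType.

Definition homogeneous (T : Type) (k : nat) (col : seq X -> T) (H : seq X) :=
  exists c, forall s, subseq s H -> size s = k -> col s = c.

(** The intermediate notion of the Erdos-Rado argument: the colour of a subsequence of length [k.+1]
    depends only on where it starts, and [C] lists these colours along [H]. *)
Fixpoint end_homogeneous (T : Type) (k : nat) (col : seq X -> T)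
    (H : seq X) (C : seq T) : Prop :=
  match H, C with
  | [::], [::] => True
  | x :: H', c :: C' =>
      (forall s, subseq s H' -> size s = k -> col (x :: s) = c) /\
      end_homogeneous k col H' C'
  | _, _ => False
  end.

Lemma end_homogeneous_size (T : Type) k (col : seq X -> T) H C :
  end_homogeneous k col H C -> size H = size C.
Proof. by elim: H C => [|x H IH] [|c C] //= [_ /IH ->]. Qed.

Lemma end_homogeneous_mask (T : eqType) k (col : seq X -> T) c H C s :
  end_homogeneous k col H C ->
  subseq s (mask [seq c' == c | c' <- C] H) -> size s = k.+1 -> col s = c.
Proof.
elim: H C s => [|x H IH] [|c' C] s //=; first by move=> _ /eqP ->.
move=> [hx hH]; case: eqP => [ec|_]; last exact: IH hH.
rewrite {}ec in hx.
case: s => [|y s] //=; case: eqP => [-> sub [sz]|_ sub sz].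
  by apply: hx => //; apply: subseq_trans sub (mask_subseq _ _).
by apply: (IH _ (y :: s) hH).
Qed.

Lemma pigeonhole_count (T : finType) N (C : seq T) :
  #|T| * N < size C -> exists c, N <= count_mem c C.
Proof.
move=> szC; apply/existsP; apply: contraLR szC.
rewrite negb_exists -leqNgt => /forallP lt.
rewrite -(sum1_size C) (partition_big id xpredT) //=.
rewrite -sum_nat_const; apply: leq_sum => c _.
by rewrite sum1_count; have := lt c; rewrite -ltnNge => /ltnW.
Qed.

(** Applying the case [k] to the colouring [col (x :: s)] of the tails, for one first entry [x]
    after another, yields a long end-homogeneous sequence. By pigeonhole one of the listed colours
    occurs [N] times, and the positions carrying it are homogeneous. *)
Theorem ramsey (T : finType) k N : exists r, forall (S : seq X) (col : seq X -> T),
  r <= size S -> exists H, [/\ subseq H S, size H = N & homogeneous k col H].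
Proof.
elim: k N => [|k IHk] N.
  exists N => S col szS; exists (take N S); split; first exact: take_subseq.
    by rewrite size_takel.
  by exists (col [::]) => s _ /size0nil ->.
have eh M : exists r, forall (S : seq X) (col : seq X -> T), r <= size S ->
    exists H C, [/\ subseq H S, size H = M & end_homogeneous k col H C].
  elim: M => [|M [r hr]].
    by exists 0 => S col _; exists [::], [::]; rewrite sub0seq.
  have [r' hr'] := IHk r; exists r'.+1 => -[//|x S] col /=; rewrite ltnS => szS.
  have [H1 [sub1 sz1 [c hc]]] := hr' S (fun s => col (x :: s)) szS.
  have [|H [C [sub sz hH]]] := hr H1 col; first by rewrite sz1.
  exists (x :: H), (c :: C); split => /=; first by rewrite eqxx (subseq_trans sub).
    by rewrite sz.
  by split => // s hs; apply: hc; apply: subseq_trans hs sub.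
have [r hr] := eh (#|T| * N).+1.
exists r => S col szS; have [H [C [sub sz hH]]] := hr S col szS.
have [|c hc] := @pigeonhole_count T N C; first by rewrite -(end_homogeneous_size hH) sz.
set H' := mask [seq c' == c | c' <- C] H.
have szH' : N <= size H'.
  rewrite size_mask ?size_map ?(end_homogeneous_size hH) //.
  by rewrite count_map (eq_count (a2 := pred1 c)).
exists (take N H'); split.
- by apply: subseq_trans (take_subseq _ _) (subseq_trans (mask_subseq _ _) sub).
- by rewrite size_takel.
exists c => s hs; apply: end_homogeneous_mask hH _.
exact: subseq_trans hs (take_subseq _ _).
Qed.

End Ramsey.

(** * The Thue-Morse word as coefficient vector of [partial] *)

Local Open Scope ring_scope.

(** The global sign differs from the usual Thue-Morse sequence by [(-1) ^+ l], so that the word is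
    exactly the coefficient vector of the linear form [partial l]. *)
Fixpoint thue_morse (l : nat) : seq int :=
  if l is l'.+1 then [seq - c | c <- thue_morse l'] ++ thue_morse l' else [:: 1].

Lemma size_thue_morse l : size (thue_morse l) = (2 ^ l)%N.
Proof. by elim: l => //= l IH; rewrite size_cat size_map IH expnS mul2n addnn. Qed.

Lemma all_sign_thue_morse l : all (fun c => (c == 1) || (c == -1)) (thue_morse l).
Proof.
elim: l => //= l IH; rewrite all_cat IH andbT all_map.
by apply: sub_all IH => c /= /orP[/eqP->|/eqP->]; rewrite ?opprK eqxx ?orbT.
Qed.

Definition dot (c x : seq int) : int := \sum_(p <- zip c x) p.1 * p.2.

Lemma dot_cat c c' x x' : size c = size x ->
  dot (c ++ c') (x ++ x') = dot c x + dot c' x'.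
Proof. by move=> sz; rewrite /dot zip_cat // big_cat. Qed.

Lemma dotN c x : dot [seq - a | a <- c] x = - dot c x.
Proof.
elim: c x => [|a c IH] [|b x]; rewrite /dot /= ?big_nil ?oppr0 //.
rewrite !big_cons /= opprD mulNr; congr (_ + _); exact: IH.
Qed.

Lemma partial_dot l x : size x = (2 ^ l)%N -> partial l x = dot (thue_morse l) x.
Proof.
elim: l x => [|l IH] x /=.
  by case: x => [|y [|]] // _; rewrite /dot /= big_seq1 mul1r.
rewrite expnS mul2n -addnn => sz.
rewrite !IH ?size_drop ?size_takel ?sz ?leq_addr ?addKn //.
rewrite -{3}(cat_take_drop (2 ^ l) x) dot_cat; last first.
  by rewrite size_map size_thue_morse size_takel // sz leq_addr.
by rewrite dotN addrC.
Qed.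

Lemma sum_thue_morse l : (0 < l)%N -> \sum_(c <- thue_morse l) c = 0.
Proof. by case: l => //= l _; rewrite big_cat big_map /= sumrN addNr. Qed.

(** * Multinomial expansion and Thue-Morse cancellation *)

Section ExponentSum.
Variable P : nat.

(* Expands a power of the linear form with coefficients s; the multinomial
   coefficients and the monomials are carried by F (see dot_expn). *)
Fixpoint exp_sum (s : seq int) (F : seq nat -> int) : int :=
  if s is c :: s' then \sum_(j < P.+1) c ^+ j * exp_sum s' (fun e => F (val j :: e))
  else F [::].

Lemma eq_exp_sum s F F' : F =1 F' -> exp_sum s F = exp_sum s F'.
Proof.
elim: s F F' => [|c s IH] F F' FF' /=; first exact: FF'.
by apply: eq_bigr => j _; congr (_ * _); apply: IH => e; apply: FF'.
Qed.

Lemma exp_sum0 s : exp_sum s (fun=> 0) = 0.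
Proof. by elim: s => //= c s IH; rewrite big1 // => j _; rewrite IH mulr0. Qed.

Lemma exp_sumD s F F' :
  exp_sum s (fun e => F e + F' e) = exp_sum s F + exp_sum s F'.
Proof.
elim: s F F' => //= c s IH F F'; rewrite -big_split /=.
by apply: eq_bigr => j _; rewrite IH mulrDr.
Qed.

Lemma exp_sumN s F : exp_sum s (fun e => - F e) = - exp_sum s F.
Proof.
elim: s F => //= c s IH F; rewrite -sumrN.
by apply: eq_bigr => j _; rewrite IH mulrN.
Qed.

Lemma exp_sumZ s a F : exp_sum s (fun e => a * F e) = a * exp_sum s F.
Proof.
elim: s F => //= c s IH F; rewrite mulr_sumr.
by apply: eq_bigr => j _; rewrite IH mulrCA.
Qed.

Lemma exp_sum_cat s t F :
  exp_sum (s ++ t) F = exp_sum s (fun e => exp_sum t (fun e' => F (e ++ e'))).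
Proof. by elim: s F => //= c s IH F; apply: eq_bigr => j _; rewrite IH. Qed.

Lemma exp_sum_opp s F :
  exp_sum [seq - c | c <- s] F = exp_sum s (fun e => (-1) ^+ sumn e * F e).
Proof.
elim: s F => //= [|c s IH] F; first by rewrite mul1r.
apply: eq_bigr => j _; rewrite IH exprNn -mulrA mulrCA; congr (_ * _).
by rewrite -exp_sumZ; apply: eq_exp_sum => e; rewrite mulrA -exprD.
Qed.

Lemma exp_sum_supp0 s F : (forall e, (0 < sumn e)%N -> F e = 0) ->
  exp_sum s F = F (nseq (size s) 0%N).
Proof.
elim: s F => //= c s IH F F0.
rewrite big_ord_recl /= expr0 mul1r IH; last by move=> e e0; apply: F0.
rewrite big1 ?addr0 // => j _.
by rewrite (@eq_exp_sum _ _ (fun=> 0)) ?exp_sum0 ?mulr0 // => e; rewrite F0.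
Qed.

(** The type of a monomial: its nonzero exponents in order, without the positions of the variables.
    After Ramsey's theorem a monomial nearly depends on its type alone. *)
Definition pos_part (e : seq nat) := [seq j <- e | (0 < j)%N].

Lemma pos_part_cat e e' : pos_part (e ++ e') = pos_part e ++ pos_part e'.
Proof. exact: filter_cat. Qed.

Lemma sumn_pos_part e : sumn (pos_part e) = sumn e.
Proof. by elim: e => //= -[|j] e /= ->. Qed.

Lemma pos_part_nseq0 k : pos_part (nseq k 0%N) = [::].
Proof. by elim: k. Qed.

Lemma pos_part0 e : sumn e = 0%N -> pos_part e = [::].
Proof. by elim: e => //= -[|j] e IH //=; apply: IH. Qed.

(* Splitting the Thue-Morse word into its two halves splits e into two parts,
   exactly one of which has odd weight; the induction hypothesis kills all terms
   except those where the other part vanishes, and these two cancel. *)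
Lemma exp_sum_thue_morse l (g : seq nat -> int) :
  (forall a, ~~ (odd (sumn a) && (sumn a < l.*2)%N) -> g a = 0) ->
  exp_sum (thue_morse l) (g \o pos_part) = 0.
Proof.
elim: l g => [|l IH] g g0.
  by rewrite (@eq_exp_sum _ _ (fun=> 0)) ?exp_sum0 // => e; rewrite /= g0 // ltn0 andbF.
rewrite /= exp_sum_cat exp_sum_opp.
set s := thue_morse l.
pose h a := exp_sum s (fun e => g (a ++ pos_part e)).
(* The four functions sort by the weight of the first half: [h1] has weight 0, [h2] odd weight below
   [l.*2], [h3] odd weight from [l.*2] on, which leaves no weight for the second half. [h4] is the
   part of [g] to which the induction hypothesis applies. *)
pose h1 a := if sumn a == 0%N then h [::] else 0.
pose h2 a := if odd (sumn a) && (sumn a < l.*2)%N then - h a else 0.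
pose h3 a := if odd (sumn a) && (sumn a < l.*2)%N then 0 else - g a.
pose h4 a := if odd (sumn a) && (sumn a < l.*2)%N then g a else 0.
have Eh e : (-1) ^+ sumn e * exp_sum s (fun e' => (g \o pos_part) (e ++ e')) =
    h1 (pos_part e) + (h2 (pos_part e) + h3 (pos_part e)).
  have -> : exp_sum s (fun e' => (g \o pos_part) (e ++ e')) = h (pos_part e).
    by apply: eq_exp_sum => e'; rewrite /= pos_part_cat.
  rewrite /h1 /h2 /h3 sumn_pos_part.
  have [e0|e0] := eqVneq (sumn e) 0%N.
    by rewrite e0 expr0 mul1r /= pos_part0 // g0 // oppr0 !addr0.
  have [oe|ee] /= := boolP (odd (sumn e)); last first.
    rewrite g0 ?sumn_pos_part ?(negbTE ee) // oppr0 !addr0.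
    rewrite /h (_ : exp_sum _ _ = 0) ?mulr0 //.
    rewrite -[RHS](IH (fun b => g (pos_part e ++ b))); first exact: eq_exp_sum.
    move=> b /negP nb; apply: g0; apply/negP => /andP[]; rewrite sumn_cat sumn_pos_part.
    move=> o lt; apply: nb; move: o; rewrite oddD (negbTE ee) /= => ->; lia.
  rewrite -signr_odd oe expr1 mulN1r add0r.
  case: ltnP => [_|le]; rewrite ?addr0 ?add0r //; congr (- _).
  rewrite /h exp_sum_supp0 ?pos_part_nseq0 ?cats0 // => e' e'0.
  rewrite g0 // sumn_cat !sumn_pos_part; apply/negP => /andP[].
  rewrite oddD oe /=; move: oe le e'0; lia.
rewrite (eq_exp_sum _ Eh) !exp_sumD.
rewrite [X in X + _]exp_sum_supp0; last first.
  by move=> e e0; rewrite /h1 sumn_pos_part; case: eqP e0 => // ->.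
rewrite pos_part_nseq0 {1}/h1 /=.
rewrite (_ : exp_sum s (fun e => h2 _) = 0); last first.
  rewrite -[RHS](IH h2); first exact: eq_exp_sum.
  by move=> a; rewrite /h2; case: ifP.
rewrite (_ : h [::] = exp_sum s (fun e => h4 (pos_part e) - h3 (pos_part e))); last first.
  by apply: eq_exp_sum => e; rewrite /h3 /h4; case: ifP; rewrite ?subr0 ?opprK ?add0r.
rewrite exp_sumD exp_sumN (_ : exp_sum s (fun e => h4 _) = 0) ?add0r ?addNr //.
rewrite -[RHS](IH h4); first exact: eq_exp_sum.
by move=> a; rewrite /h4; case: ifP.
Qed.

(** The multinomial coefficient of [e] if the exponents sum to [p], and 0 otherwise. *)
Fixpoint mult (p : nat) (e : seq nat) : int :=
  if e is j :: e' then 'C(p, j)%:R * mult (p - j) e' else (p == 0%N)%:R.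

Lemma mult_supp p e : sumn e != p -> mult p e = 0.
Proof.
elim: e p => [|j e IH] p /= ne; first by case: p ne.
have [le|lt] := leqP j p; last by rewrite bin_small // mul0r.
by rewrite IH ?mulr0 // -(eqn_add2l j) subnKC.
Qed.

Lemma mult_pos_part p e : mult p (pos_part e) = mult p e.
Proof.
elim: e p => //= -[|j] e IH p /=; first by rewrite bin0 mul1r subn0 IH.
by rewrite IH.
Qed.

Definition monomial (x : seq int) (e : seq nat) : int :=
  \prod_(p <- zip x e) p.1 ^+ p.2.

Lemma monomial_cons y x j e : monomial (y :: x) (j :: e) = y ^+ j * monomial x e.
Proof. by rewrite /monomial /= big_cons. Qed.

Lemma dot_cons a b c x : dot (a :: c) (b :: x) = a * b + dot c x.
Proof. by rewrite /dot /= big_cons. Qed.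

(** The multinomial theorem. All exponents up to the common bound [P] are summed over, so that
    powers of different degrees live in one and the same [exp_sum]. *)
Lemma dot_expn c x p : (p <= P)%N -> size c = size x ->
  dot c x ^+ p = exp_sum c (fun e => mult p e * monomial x e).
Proof.
elim: c x p => [|a c IH] [|b x] p //= pP.
  by rewrite /dot /monomial !big_nil mulr1; case: p {pP} => [|p] //; rewrite expr0n.
move=> [sz]; rewrite dot_cons addrC exprDn.
pose t i := dot c x ^+ (p - i) * (a * b) ^+ i *+ 'C(p, i).
rewrite (@big_ord_widen _ _ _ p.+1 P.+1 t) // big_mkcond /= {}/t.
apply: eq_bigr => j _; rewrite ltnS; case: leqP => [jp|lt].
  rewrite IH // ?(leq_trans (leq_subr _ _)) // -mulr_natl exprMn.
  rewrite mulrA mulrAC -[RHS]mulr1 -!exp_sumZ mulr1; apply: eq_exp_sum => e.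
  rewrite monomial_cons; ring.
rewrite (@eq_exp_sum _ _ (fun=> 0)) ?exp_sum0 ?mulr0 // => e.
by rewrite bin_small // !mul0r.
Qed.

(** The variables that really occur form a subsequence as long as the type; such subsequences are
    what the Ramsey colouring sees. *)
Lemma monomial_pos_part x e : size x = size e ->
  monomial x e = monomial (mask [seq (0 < j)%N | j <- e] x) (pos_part e).
Proof.
elim: e x => [|j e IH] [|y x] //= [sz]; case: j => [|j] /=.
  by rewrite monomial_cons expr0 mul1r IH.
by rewrite !monomial_cons IH.
Qed.

Fixpoint exponents (k : nat) : seq (seq nat) :=
  if k is k'.+1 then [seq j :: e | j <- iota 0 P.+1, e <- exponents k'] else [:: [::]].

Lemma size_exponents k e : e \in exponents k -> size e = k.
Proof.
elim: k e => [|k IH] e; first by rewrite inE => /eqP ->.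
by case/allpairsPdep => j [e' [_ /IH <- ->]].
Qed.

End ExponentSum.

(** * Recurrence of odd polynomials for totally bounded quasinorms *)

Section Bohr.
Variable R : realType.

(** Modelled on [psi 0 - psi x], half of a squared distance between translates: hence the factors 2
    in the triangle inequality. *)
Record quasinorm (q : int -> R) : Prop := {
  qnorm0 : q 0 = 0 ;
  qnorm_ge0 : forall x, 0 <= q x ;
  qnormN : forall x, q (- x) = q x ;
  qnormD : forall x y, q (x + y) <= 2 * q x + 2 * q y }.

(** Phrased by the absence of long separated sequences instead of by finite nets, because this form
    combines directly with Ramsey's theorem. *)
Definition totally_bounded (q : int -> R) : Prop :=
  forall delta, 0 < delta -> exists N, forall S : seq int, (N <= size S)%N ->
    exists a b, subseq [:: a; b] S /\ q (b - a) < delta.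

Variable q : int -> R.
Hypothesis qP : quasinorm q.
Hypothesis qtb : totally_bounded q.

(** Without a finite net, a separated sequence could be prolonged forever by a point far from all
    its entries. *)
Lemma totally_bounded_net delta : 0 < delta ->
  exists s : seq int, forall m, exists2 c, c \in s & q (m - c) < delta.
Proof.
move=> d0; have [N hN] := qtb d0; apply: contrapT => nex.
suff: forall n, exists S : seq int, size S = n /\
    forall a b, subseq [:: a; b] S -> delta <= q (b - a).
  move=> /(_ N) [S [szS sep]]; have [|a [b [sub lt]]] := hN S; first by rewrite szS.
  by have := sep _ _ sub; rewrite leNgt lt.
elim=> [|n [S [szS sep]]]; first by exists [::].
have [m hm] : exists m, forall c, c \in S -> delta <= q (m - c).
  apply: contrapT => nm; apply: nex; exists S => m; apply: contrapT => nc.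
  apply: nm; exists m => c cS; rewrite leNgt; apply/negP => lt.
  by apply: nc; exists c.
exists (m :: S); split=> [|a b]; first by rewrite /= szS.
rewrite /=; case: eqP => [->|_] sub; last exact: sep.
by rewrite -qnormN // opprB; apply: hm; rewrite -sub1seq.
Qed.

Lemma qnorm_sum n (F : 'I_n -> int) (eta : R) : 0 <= eta ->
  (forall i, q (F i) <= eta) -> q (\sum_(i < n) F i) <= 4 ^+ n * eta.
Proof.
move=> eta0; elim: n F => [|n IH] F hF.
  by rewrite big_ord0 qnorm0 // expr0 mul1r.
rewrite big_ord_recl; apply: le_trans (qnormD qP _ _) _.
have h1 := hF ord0; have h2 := IH (fun i => F (lift ord0 i)) (fun i => hF _).
have h3 : 1 <= (4 : R) ^+ n by apply: exprn_ege1; lra.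
rewrite exprS; nra.
Qed.

(** Signs are invisible to the even function [q], so only the number of terms matters; [C] depends
    on [P] and [s] but not on [F]. *)
Lemma qnorm_exp_sum P s : all (fun c => (c == 1) || (c == -1)) s ->
  exists2 C : R, 0 <= C & forall F eta, 0 <= eta ->
    (forall e, e \in exponents P (size s) -> q (F e) <= eta) ->
    q (exp_sum P s F) <= C * eta.
Proof.
elim: s => [|c s IH].
  by move=> _; exists 1 => // F eta _ h; rewrite mul1r; apply: h; rewrite inE.
rewrite [all _ _]/= => /andP[hc /IH [C C0 hC]]; exists (4 ^+ P.+1 * C).
  by rewrite mulr_ge0 // exprn_ge0.
move=> F eta eta0 h; rewrite -mulrA; apply: qnorm_sum => [|j]; first exact: mulr_ge0.
have -> : q (c ^+ j * exp_sum P s (fun e => F (val j :: e))) =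
    q (exp_sum P s (fun e => F (val j :: e))).
  case/orP: hc => /eqP ->; first by rewrite expr1n mul1r.
  by rewrite -signr_odd; case: odd; rewrite ?expr1 ?mulN1r ?qnormN // expr0 mul1r.
apply: hC => // e he; apply: h; apply/allpairsPdep; exists (val j), e; split => //.
by rewrite mem_iota /= add0n.
Qed.

(** A finite net turns the approximate value of [f a y] into a colour with finitely many values;
    Ramsey's theorem is then applied to one type [a] after another. *)
Lemma multi_ramsey (A : seq (seq nat)) (f : seq nat -> seq int -> int) (eta : R) N :
  0 < eta -> exists r, forall S : seq int, (r <= size S)%N ->
  exists H, [/\ subseq H S, size H = N & forall a, a \in A ->
    exists c, forall y, subseq y H -> size y = size a -> q (f a y - c) <= eta].
Proof.
move=> eta0; have [s hs] := totally_bounded_net eta0.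
pose col a y : 'I_(size s).+1 := inord (find (fun c => q (f a y - c) < eta) s).
have colP a y : q (f a y - nth 0 s (col a y)) < eta.
  have hh : has (fun c => q (f a y - c) < eta) s.
    by have [c cs lt] := hs (f a y); apply/hasP; exists c.
  by rewrite inordK ?ltnS ?find_size //; apply: (nth_find 0 hh).
elim: A => [|a A [r IH]].
  exists N => S szS; exists (take N S); split=> //; first exact: take_subseq.
  by rewrite size_takel.
have [r' hr'] := @ramsey int 'I_(size s).+1 (size a) r.
exists r' => S szS; have [H' [sub' sz' [c hc]]] := hr' S (col a) szS.
have [|H [sub sz hH]] := IH H'; first by rewrite sz'.
exists H; split=> //; first exact: subseq_trans sub sub'.
move=> a'; rewrite inE => /predU1P[->|]; last exact: hH.
exists (nth 0 s c) => y suby szy; rewrite -(hc y) //; first exact/ltW/colP.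
exact: subseq_trans suby sub.
Qed.

(** On a suitable [x] every term of the expansion is close to a constant depending only on its type.
    Replacing the terms by these constants gives a sum that vanishes by [exp_sum_thue_morse], since
    only odd weights below [l.*2] occur; the error is a bounded number of small terms. *)
Lemma odd_int_poly_recurrence l (b : nat -> int) (delta : R) : 0 < delta ->
  exists r, forall S : seq int, (r <= size S)%N ->
  exists x, [/\ subseq x S, size x = (2 ^ l)%N &
    q (\sum_(1 <= j < l.+1) b j * partial l x ^+ (2 * j - 1)) < delta].
Proof.
move=> d0; pose P := l.*2.
have [C C0 hC] := @qnorm_exp_sum P (thue_morse l) (all_sign_thue_morse l).
pose eta := delta / (C + 1).
have eta0 : 0 < eta by rewrite divr_gt0 // ltr_wpDl.
(* The total multinomial weight, over all degrees of the polynomial, that a monomial of type [a]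
   receives. *)
pose w a := \sum_(1 <= j < l.+1) b j * mult (2 * j - 1) a.
pose A := map pos_part (exponents P (2 ^ l)).
have [r hr] := multi_ramsey A (fun a y => w a * monomial y a) (2 ^ l) eta0.
exists r => S szS; have [x [sub sz hx]] := hr S szS; exists x; split => //.
pose odd_small a := odd (sumn a) && (sumn a < l.*2)%N.
have w0 a : ~~ odd_small a -> w a = 0.
  move=> na; rewrite /w big_nat big1 // => j /andP[j1 jl].
  rewrite mult_supp ?mulr0 //; apply: contraNneq na => sa; rewrite /odd_small sa.
  apply/andP; lia.
have /boolp.choice[g hg] : forall a, exists c, a \in A -> forall y, subseq y x -> size y = size a ->
    q (w a * monomial y a - c) <= eta.
  move=> a; have [aA|naA] := boolP (a \in A); last by exists 0.
  by have [c hc] := hx a aA; exists c.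
pose g' a := if odd_small a then g a else 0.
(* The subtracted constants [g'] add up to 0, so they can be inserted freely. *)
have -> : \sum_(1 <= j < l.+1) b j * partial l x ^+ (2 * j - 1) =
    exp_sum P (thue_morse l) (fun e => w e * monomial x e - g' (pos_part e)).
  rewrite exp_sumD exp_sumN [X in _ - X](@exp_sum_thue_morse P l g'); last first.
    by move=> a na; rewrite /g' /odd_small (negbTE na).
  rewrite subr0 partial_dot //.
  have eqw e : w e * monomial x e =
      \sum_(1 <= j < l.+1) b j * (mult (2 * j - 1) e * monomial x e).
    by rewrite /w mulr_suml; apply: eq_bigr => j _; rewrite mulrA.
  rewrite (eq_exp_sum _ _ eqw).
  have exp_sum_sum r' : exp_sum P (thue_morse l) (fun e =>
      \sum_(j <- r') b j * (mult (2 * j - 1) e * monomial x e)) =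
      \sum_(j <- r') b j * exp_sum P (thue_morse l) (fun e => mult (2 * j - 1) e * monomial x e).
    elim: r' => [|j r' IH].
      by rewrite big_nil -[RHS](exp_sum0 P (thue_morse l)); apply: eq_exp_sum => e; rewrite big_nil.
    rewrite big_cons -IH -exp_sumZ -exp_sumD.
    by apply: eq_exp_sum => e; rewrite big_cons.
  rewrite exp_sum_sum big_nat [RHS]big_nat; apply: eq_bigr => j /andP[j1 jl].
  by rewrite (@dot_expn P) ?size_thue_morse ?sz // /P; lia.
apply: le_lt_trans (hC _ eta (ltW eta0) _) _; last first.
  by rewrite /eta mulrA ltr_pdivrMr ?ltr_wpDl // mulrDr mulr1 mulrC ltrDl.
move=> e; rewrite size_thue_morse => he.
have sze := size_exponents he.
have -> : w e = w (pos_part e).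
  by rewrite /w; apply: eq_bigr => j _; rewrite mult_pos_part.
rewrite monomial_pos_part ?sze ?sz // /g'.
case: ifPn => [os|/w0 ->]; last by rewrite mul0r subr0 qnorm0 // ltW.
apply: hg; first exact: map_f.
  exact: mask_subseq.
rewrite size_mask ?size_map ?sze ?sz // /pos_part size_filter count_map.
exact: eq_count.
Qed.

Lemma dot_affine c x (a D : int) : size c = size x ->
  dot c [seq a + D * y | y <- x] = a * (\sum_(i <- c) i) + D * dot c x.
Proof.
elim: c x => [|i c IH] [|y x] //=.
  by move=> _; rewrite /dot /= !big_nil !mulr0.
move=> [sz]; rewrite !dot_cons IH // big_cons; ring.
Qed.

(** Ramsey's theorem for one-element subsequences selects entries in a single residue class modulo
    [D]. As the coefficients of [partial] sum to 0, the common residue drops out and [partial]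
    becomes a multiple of [D]; this cancels the denominator, leaving the integer coefficients
    [b j * D ^+ (2 * j - 2)]. *)
Lemma odd_poly_recurrence l (D : nat) (b : nat -> int) (v : int -> int) (delta : R) :
  (0 < l)%N -> (0 < D)%N ->
  (forall z, D%:Z * v z = \sum_(1 <= j < l.+1) b j * z ^+ (2 * j - 1)) ->
  0 < delta -> exists r, forall S : seq int, (r <= size S)%N ->
  exists x, [/\ subseq x S, size x = (2 ^ l)%N & q (v (partial l x)) < delta].
Proof.
case: D => // D l0 _ hv d0.
have [r hr] := odd_int_poly_recurrence l (fun j => b j * D.+1%:Z ^+ (2 * j - 2)) d0.
have [r' hr'] := @ramsey int 'I_D.+1 1 r.
exists r' => S szS.
pose col (s : seq int) : 'I_D.+1 := inord `|(head 0 s %% D.+1)%Z|%N.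
have [H [sub sz [c hc]]] := hr' S col szS.
have resid y : y \in H -> y = (c : nat)%:Z + D.+1%:Z * (y %/ D.+1)%Z.
  move=> yH; rewrite {1}(divz_eq y D.+1) addrC mulrC; congr (_ + _).
  rewrite -(hc [:: y]) ?sub1seq // /col /= inordK; first by rewrite gez0_abs // modz_ge0.
  by rewrite -ltz_nat gez0_abs ?modz_ge0 // ltz_pmod.
have [|x [subx szx hx]] := hr [seq (y %/ D.+1)%Z | y <- H]; first by rewrite size_map sz.
have [m _ xE] := subseqP subx.
exists [seq (c : nat)%:Z + D.+1%:Z * y | y <- x]; split.
- apply: subseq_trans sub; rewrite xE -map_mask -map_comp.
  rewrite (_ : map _ _ = mask m H) ?mask_subseq //.
  rewrite -[RHS]map_id; apply/eq_in_map => y /mem_mask yH /=.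
  by rewrite -resid.
- by rewrite size_map.
move: hx; rewrite !partial_dot ?size_map // dot_affine ?size_thue_morse ?szx //.
rewrite sum_thue_morse // mulr0 add0r => hx.
rewrite (_ : v _ = \sum_(1 <= j < l.+1) b j * D.+1%:Z ^+ (2 * j - 2) *
   dot (thue_morse l) x ^+ (2 * j - 1)) //.
apply: (@mulfI _ D.+1%:Z) => //; rewrite hv [RHS]mulr_sumr big_nat [RHS]big_nat.
apply: eq_bigr => j /andP[j1 _].
have -> : (2 * j - 1 = (2 * j - 2).+1)%N by lia.
rewrite exprMn [D.+1%:Z ^+ _.+1]exprS; ring.
Qed.

End Bohr.

(** * Positive definite sequences *)

Section PosDef.
Variable R : realType.
Implicit Types (phi psi : int -> R) (s : seq (R * int)).

Definition pd_form phi s : R :=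
  \sum_(p <- s) \sum_(r <- s) p.1 * r.1 * phi (p.2 - r.2).

Record posdef phi : Prop := {
  pd_sym : forall x, phi (- x) = phi x ;
  pd_ge0 : forall s, 0 <= pd_form phi s }.

Lemma pd_symB phi x y : posdef phi -> phi (x - y) = phi (y - x).
Proof. by move=> /pd_sym h; rewrite -h opprB. Qed.

Lemma pd_form_cons phi p s : posdef phi ->
  pd_form phi (p :: s) =
    phi 0 * p.1 ^+ 2 + 2 * (\sum_(r <- s) r.1 * phi (r.2 - p.2)) * p.1 + pd_form phi s.
Proof.
move=> pd; rewrite /pd_form !big_cons subrr.
under [X in _ + X = _]eq_bigr do rewrite big_cons.
rewrite big_split /=.
have -> : \sum_(r <- s) p.1 * r.1 * phi (p.2 - r.2) = p.1 * \sum_(r <- s) r.1 * phi (r.2 - p.2).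
  by rewrite mulr_sumr; apply: eq_bigr => r _; rewrite (pd_symB _ _ pd) mulrA.
have -> : \sum_(i <- s) i.1 * p.1 * phi (i.2 - p.2) = p.1 * \sum_(r <- s) r.1 * phi (r.2 - p.2).
  by rewrite mulr_sumr; apply: eq_bigr => r _; ring.
ring.
Qed.

Lemma pd_form_nil phi : pd_form phi [::] = 0.
Proof. by rewrite /pd_form big_nil. Qed.

Lemma quadratic_ge0_discr (a b c : R) : 0 <= a ->
  (forall t, 0 <= a * t ^+ 2 + 2 * b * t + c) -> b ^+ 2 <= a * c.
Proof.
rewrite le_eqVlt => /predU1P[<-|a0] h.
  have [->|b0] := eqVneq b 0; first by rewrite expr2 !mul0r.
  have := h (- (c + 1) / (2 * b)).
  have -> : 0 * (- (c + 1) / (2 * b)) ^+ 2 + 2 * b * (- (c + 1) / (2 * b)) + c = -1 by field.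
  by rewrite lerNr oppr0 ler10.
have := h (- b / a).
have -> : a * (- b / a) ^+ 2 + 2 * b * (- b / a) + c = (a * c - b ^+ 2) / a.
  by field; rewrite gt_eqF.
by rewrite pmulr_lge0 ?invr_gt0 // subr_ge0.
Qed.

Lemma pd0_ge0 phi : posdef phi -> 0 <= phi 0.
Proof.
move=> pd; have := pd_ge0 pd [:: (1, 0)].
by rewrite pd_form_cons // pd_form_nil big_nil /= mulr0 mul0r expr1n mulr1 !addr0.
Qed.

(** The form on [s] with the extra point [- z] of weight [t] is a nonnegative quadratic polynomial
    in [t]; the claim is its discriminant inequality. *)
Lemma pd_cauchy_schwarz phi s z : posdef phi ->
  (\sum_(r <- s) r.1 * phi (r.2 + z)) ^+ 2 <= phi 0 * pd_form phi s.
Proof.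
move=> pd; apply: quadratic_ge0_discr; first exact: pd0_ge0.
move=> t; have := pd_ge0 pd ((t, - z) :: s); rewrite pd_form_cons //=.
by under [in X in 2 * X]eq_bigr do rewrite opprK.
Qed.

Lemma pd_two phi x (c : R) : posdef phi ->
  0 <= phi 0 + 2 * c * phi x + c ^+ 2 * phi 0.
Proof.
move=> pd; have := pd_ge0 pd [:: (1, 0); (c, x)].
rewrite !pd_form_cons // pd_form_nil !big_cons !big_nil /= subr0.
lra.
Qed.

Lemma pd_norm_le phi x : posdef phi -> `|phi x| <= phi 0.
Proof.
move=> pd; have h1 := pd_two x 1 pd; have h2 := pd_two x (-1) pd.
by rewrite ler_norml; apply/andP; split; nra.
Qed.

Lemma pd_qnorm phi : posdef phi -> quasinorm (fun x => phi 0 - phi x).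
Proof.
move=> pd; split; first exact: subrr.
- by move=> x; have := pd_norm_le x pd; rewrite ler_norml subr_ge0 => /andP[].
- by move=> x; rewrite pd_sym.
(* The weights 1, -2, 1 encode the parallelogram law for the path from 0 through [y] to [x + y]. *)
move=> x y; have := pd_ge0 pd [:: (1, x + y); (-2, y); (1, 0)].
rewrite !pd_form_cons // pd_form_nil !big_cons !big_nil /= !sub0r.
rewrite (_ : y - (x + y) = - x); last by ring.
rewrite !pd_sym //; lra.
Qed.

Lemma pd_formD phi psi s :
  pd_form (fun x => phi x + psi x) s = pd_form phi s + pd_form psi s.
Proof.
rewrite /pd_form -big_split; apply: eq_bigr => p _ /=.
by rewrite -big_split; apply: eq_bigr => r _ /=; rewrite mulrDr.
Qed.

Lemma pd_formZ a phi s : pd_form (fun x => a * phi x) s = a * pd_form phi s.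
Proof.
rewrite /pd_form mulr_sumr; apply: eq_bigr => p _ /=.
by rewrite mulr_sumr; apply: eq_bigr => r _ /=; rewrite mulrCA.
Qed.

Lemma posdefD phi psi : posdef phi -> posdef psi -> posdef (fun x => phi x + psi x).
Proof.
move=> h1 h2; split=> [x|s]; first by rewrite !pd_sym.
by rewrite pd_formD addr_ge0 // pd_ge0.
Qed.

End PosDef.

(** * Van der Corput's trick along polynomials *)

Section VanDerCorput.
Variable R : realType.

(** Applied to nonnegative [u]. The uniformity in the starting point [M] is what upper Banach
    density requires. *)
Definition unif_null (u : nat -> R) : Prop :=
  forall eps, 0 < eps -> exists L, forall M n, (L <= n)%N ->
    \sum_(i < n) u (M + i)%N <= eps * n%:R.

(** The inequality of arithmetic and geometric means; with a well-chosen [s] it takes over the role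
    of Cauchy-Schwarz for averages. *)
Lemma le_half_sq (x s : R) : 0 < s -> `|x| <= (s + x ^+ 2 / s) / 2.
Proof.
move=> s0; rewrite ler_pdivlMr // -(ler_pM2r s0) mulrDl divfK ?gt_eqF //.
by rewrite -(real_normK (num_real x)); have := sqr_ge0 (`|x| - s); lra.
Qed.

Lemma unif_null_norm (u : nat -> R) :
  unif_null (fun n => u n ^+ 2) -> unif_null (fun n => `|u n|).
Proof.
move=> h eps e0; have [L hL] := h (eps ^+ 2) (exprn_gt0 _ e0).
exists L => M n /(hL M) le.
have : \sum_(i < n) `|u (M + i)%N| <= \sum_(i < n) (eps + u (M + i)%N ^+ 2 / eps) / 2.
  by apply: ler_sum => i _; exact: le_half_sq.
move/le_trans; apply; rewrite -mulr_suml big_split /= -mulr_suml.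
rewrite sumr_const card_ord -mulr_natr ler_pdivrMr //.
have : (\sum_(i < n) u (M + i)%N ^+ 2) / eps <= eps * n%:R.
  by rewrite ler_pdivrMr //; lra.
lra.
Qed.

Lemma sum_shift_le (u : nat -> R) n h : (forall i, 0 <= u i <= 1) ->
  \sum_(i < n) u i <= \sum_(i < n) u (i + h)%N + h%:R.
Proof.
move=> u01; apply: (@le_trans _ _ (\sum_(i < h + n) u i)).
  rewrite addnC big_split_ord /= lerDl; apply: sumr_ge0 => i _.
  by case/andP: (u01 (n + i)%N).
rewrite big_split_ord /= addrC lerD //.
  by apply: ler_sum => i _; rewrite addnC.
apply: le_trans (_ : \sum_(i < h) 1 <= _).
  by apply: ler_sum => i _; case/andP: (u01 i).
by rewrite sumr_const card_ord.
Qed.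

Variable phi : int -> R.
Hypothesis pd : posdef phi.
Hypothesis phi1 : phi 0 <= 1.

Lemma phi_sq_bound x : 0 <= phi x ^+ 2 <= 1.
Proof.
rewrite sqr_ge0 /= -(real_normK (num_real _)) expr_le1 //.
exact: le_trans (pd_norm_le x pd) phi1.
Qed.

Lemma pd_window_le (w : nat -> int) H :
  (\sum_(h < H) phi (w h) ^+ 2) ^+ 2 <=
  \sum_(h < H) \sum_(h' < H) `|phi (w h - w h')|.
Proof.
pose s := [seq (phi (w h), w h) | h : 'I_H <- index_enum 'I_H].
have -> : \sum_(h < H) phi (w h) ^+ 2 = \sum_(r <- s) r.1 * phi (r.2 + 0).
  by rewrite big_map; apply: eq_bigr => h _; rewrite addr0 expr2.
apply: le_trans (pd_cauchy_schwarz _ _ pd) _.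
apply: le_trans (_ : pd_form phi s <= _).
  by rewrite ler_piMl // pd_ge0.
rewrite /pd_form big_map; apply: ler_sum => h _.
rewrite big_map; apply: ler_sum => h' _ /=.
apply: le_trans (ler_norm _) _; rewrite !normrM ler_piMl //.
rewrite mulr_ile1 //; exact: le_trans (pd_norm_le _ pd) phi1.
Qed.

(** Averaging over [H] shifts changes the sum by a boundary term only. Each window of length [H] is
    then bounded by [pd_window_le], which replaces [w] by its differences. *)
Lemma van_der_corput (w : nat -> int) :
  (forall eta, 0 < eta -> exists2 H, (0 < H)%N & exists L, forall M n, (L <= n)%N ->
    \sum_(i < n) \sum_(h < H) \sum_(h' < H)
       `|phi (w (M + i + h)%N - w (M + i + h')%N)| <= eta ^+ 2 * H%:R ^+ 2 * n%:R) ->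
  unif_null (fun n => phi (w n) ^+ 2).
Proof.
move=> hw eps eps0; have eta0 : 0 < eps / 2 by rewrite divr_gt0.
move: (eps / 2) eta0 (esym (splitr eps)) => eta eta0 <- {eps eps0}.
have [H H0 [L hL]] := hw eta eta0.
(* The second bound makes [H <= eta * n], so the boundary term costs at most [eta * n]. *)
exists (maxn L (Num.bound (H%:R / eta))) => M n; rewrite geq_max => /andP[Ln bn].
have Hn : H%:R <= eta * n%:R.
  rewrite mulrC -ler_pdivrMr //; apply: le_trans (_ : (Num.bound (H%:R / eta))%:R <= _).
    by apply/ltW/archi_boundP; rewrite divr_ge0 // ltW.
  by rewrite ler_nat.
have HR : 0 < H%:R :> R by rewrite ltr0n.
have {}hL := hL M n Ln.
set Q := \sum_(i < n) _ in hL.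
have step1 : H%:R * \sum_(i < n) phi (w (M + i)%N) ^+ 2 <=
    \sum_(i < n) \sum_(h < H) phi (w (M + i + h)%N) ^+ 2 + H%:R * H%:R.
  have cst (x : R) : H%:R * x = \sum_(h < H) x by rewrite sumr_const card_ord mulr_natl.
  rewrite exchange_big /= !cst -big_split /=.
  apply: ler_sum => h _.
  have := @sum_shift_le (fun i => phi (w (M + i)%N) ^+ 2) n h (fun i => phi_sq_bound _).
  move/le_trans; apply; rewrite lerD ?ler_nat ?(ltnW (ltn_ord _)) //.
  by apply: ler_sum => i _; rewrite addnA.
have step2 : \sum_(i < n) \sum_(h < H) phi (w (M + i + h)%N) ^+ 2 <=
    (eta * H%:R * n%:R + Q / (eta * H%:R)) / 2.
  apply: le_trans (_ : \sum_(i < n) (eta * H%:R +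
    (\sum_(h < H) \sum_(h' < H)
       `|phi (w (M + i + h)%N - w (M + i + h')%N)|) / (eta * H%:R)) / 2 <= _).
    apply: ler_sum => i _; apply: le_trans (ler_norm _) _.
    apply: le_trans (le_half_sq _ (mulr_gt0 eta0 HR)) _.
    rewrite ler_pM2r ?invr_gt0 // lerD2l ler_pM2r ?invr_gt0 ?mulr_gt0 //.
    exact: (pd_window_le (fun h => w (M + i + h)%N)).
  rewrite -mulr_suml big_split /= -[X in _ + X]mulr_suml sumr_const card_ord.
  by rewrite -[(eta * H%:R) *+ n]mulr_natr.
have step3 : Q / (eta * H%:R) <= eta * H%:R * n%:R.
  by rewrite ler_pdivrMr ?mulr_gt0 //; move: hL; lra.
rewrite -(ler_pM2l HR); apply: le_trans step1 _.
have : H%:R * H%:R <= H%:R * (eta * n%:R) :> R by rewrite ler_pM2l.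
move: step2 step3; lra.
Qed.

(** Each distance from [h] is attained at most twice, once on either side. *)
Lemma sum_dist_le (g : nat -> R) H h : (forall k, 0 <= g k) -> (h < H)%N ->
  \sum_(h' < H) g `|h%:Z - h'%:Z|%N <= 2 * \sum_(k < H) g k.
Proof.
move=> g0 hH; rewrite -(big_mkord xpredT (fun k => g `|h%:Z - k%:Z|%N)).
rewrite -(big_mkord xpredT g) (@big_cat_nat _ _ _ h 0%N H) //=; last exact: ltnW.
have mono k : (k <= H)%N -> \sum_(0 <= i < k) g i <= \sum_(0 <= i < H) g i.
  move=> kH; rewrite (@big_cat_nat _ _ _ k 0 H) //= lerDl.
  by apply: sumr_ge0.
have -> : \sum_(0 <= i < h) g `|h%:Z - i%:Z|%N = \sum_(1 <= i < h.+1) g i.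
  rewrite big_nat_rev /= big_add1 /= add0n big_nat [RHS]big_nat.
  by apply: eq_bigr => i /andP[_ ih]; congr g; lia.
have -> : \sum_(h <= i < H) g `|h%:Z - i%:Z|%N = \sum_(0 <= i < H - h) g i.
  rewrite -{1}[h]add0n big_addn; apply: eq_bigr => i _; congr g; lia.
have h1 : \sum_(1 <= i < h.+1) g i <= \sum_(0 <= i < h.+1) g i.
  by rewrite [leRHS]big_ltn // lerDr.
have h2 := mono h.+1 hH; have h3 := mono (H - h)%N (leq_subr _ _).
lra.
Qed.

(** The differences of an affine sequence depend on [h - h'] only, so the bound is the same for
    every window, whatever its starting point. *)
Lemma vdc_affine (a b : int) (w : nat -> int) : (forall n, w n = a * n%:Z + b) ->
  (forall eps, 0 < eps -> exists2 H, (0 < H)%N &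
     \sum_(k < H) `|phi (a * k%:Z)| <= eps * H%:R) ->
  unif_null (fun n => phi (w n) ^+ 2).
Proof.
move=> wE hH; apply: van_der_corput => eta eta0.
have [|H H0 hs] := hH (eta ^+ 2 / 2); first by rewrite divr_gt0 ?exprn_gt0.
exists H => //; exists 0%N => M n _.
apply: le_trans (_ : \sum_(i < n) (eta ^+ 2 * H%:R ^+ 2) <= _); last first.
  by rewrite sumr_const card_ord mulr_natr.
apply: ler_sum => i _.
apply: le_trans (_ : \sum_(h < H) (eta ^+ 2 * H%:R) <= _); last first.
  by rewrite sumr_const card_ord expr2 mulrA [leRHS]mulr_natr.
apply: ler_sum => h _.
have -> : \sum_(h' < H) `|phi (w (M + i + h)%N - w (M + i + h')%N)| =
  \sum_(h' < H) (fun k : nat => `|phi (a * k%:Z)|) `|(h : nat)%:Z - (h' : nat)%:Z|%N.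
  apply: eq_bigr => h' _ /=; congr `| _ |; rewrite !wE.
  have -> : a * (M + i + h)%N%:Z + b - (a * (M + i + h')%N%:Z + b) =
    a * ((h : nat)%:Z - (h' : nat)%:Z) by rewrite !PoszD; ring.
  rewrite abszE; case: (leP 0 ((h : nat)%:Z - (h' : nat)%:Z)) => le.
    by rewrite ger0_norm.
  by rewrite ltr0_norm // mulrN pd_sym.
apply: le_trans (sum_dist_le (g := fun k : nat => `|phi (a * k%:Z)|) _ (ltn_ord h)) _.
  by move=> k.
by move: hs; lra.
Qed.

Lemma sum_multiples_le (g : nat -> R) A H : (forall k, 0 <= g k) -> (0 < A)%N ->
  \sum_(k < H) g (A * k)%N <= \sum_(k < A * H) g k.
Proof.
move=> g0; case: A => // A _; elim: H => [|H IH]; first by rewrite muln0 !big_ord0.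
rewrite mulnS addnC big_split_ord big_ord_recr /= lerD //.
by rewrite big_ord_recl /= addn0 lerDl sumr_ge0.
Qed.

(* Polynomials, seen through the differences that van der Corput's trick
   produces; the degree drops at each application of nonconst_diff. *)
Inductive nonconst_poly : (nat -> int) -> Prop :=
| nonconst_affine (a b : int) (w : nat -> int) :
    a != 0 -> (forall n, w n = a * n%:Z + b) -> nonconst_poly w
| nonconst_diff (w : nat -> int) :
    (forall h h', h != h' -> nonconst_poly (fun n => w (n + h)%N - w (n + h')%N)) ->
    nonconst_poly w.

Hypothesis mean0 : forall eps, 0 < eps -> exists2 N, (0 < N)%N &
  \sum_(n < N) phi n%:Z ^+ 2 <= eps * N%:R.

(** One small initial average for each [eps] is enough: its length serves as the van der Corput
    window, and smallness becomes uniform over all intervals. *)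
Lemma unif_null_id : unif_null (fun n => phi n%:Z ^+ 2).
Proof.
apply: (@vdc_affine 1 0 Posz) => [n|eps e0]; first by rewrite mul1r addr0.
have [N N0 hN] := mean0 (exprn_gt0 2 e0); exists N => //.
have : \sum_(k < N) `|phi (1 * (k : nat)%:Z)| <= \sum_(k < N) (eps + phi (k : nat)%:Z ^+ 2 / eps) / 2.
  by apply: ler_sum => i _; rewrite mul1r; exact: le_half_sq.
move/le_trans; apply; rewrite -mulr_suml big_split /= -mulr_suml.
rewrite sumr_const card_ord -mulr_natr ler_pdivrMr //.
have : (\sum_(i < N) phi (i : nat)%:Z ^+ 2) / eps <= eps * N%:R.
  by rewrite ler_pdivrMr //; lra.
lra.
Qed.

Theorem unif_null_poly (w : nat -> int) : nonconst_poly w ->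
  unif_null (fun n => phi (w n) ^+ 2).
Proof.
elim=> {w} [a b w a0 wE|w _ IH].
  apply: (vdc_affine wE) => eps e0.
  have A0 : (0 < `|a|)%N by rewrite absz_gt0.
  (* The multiples of [a] are compared with all of an interval that is [|a|] times as long, which
     costs the factor [|a|]. *)
  have [|L hL] := unif_null_norm unif_null_id (eps := eps / `|a|%N%:R).
    by rewrite divr_gt0 // ltr0n.
  exists L.+1 => //.
  have -> : \sum_(k < L.+1) `|phi (a * k%:Z)| =
     \sum_(k < L.+1) (fun n : nat => `|phi n%:Z|) (`|a| * k)%N.
    apply: eq_bigr => k _; congr `| _ |; rewrite PoszM abszE.
    case: (leP 0 a) => le; first by rewrite ger0_norm.
    by rewrite ltr0_norm // mulNr pd_sym.
  apply: le_trans (sum_multiples_le _ (g := fun n : nat => `|phi n%:Z|) _ A0) _ => //.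
  have Ln : (L <= `|a| * L.+1)%N by rewrite (leq_trans (leqnSn L)) // leq_pmull.
  apply: le_trans (hL 0%N _ Ln) _.
  rewrite natrM mulrA divfK // pnatr_eq0; lia.
apply: van_der_corput => eta eta0.
have e20 : 0 < eta ^+ 2 / 2 by rewrite divr_gt0 ?exprn_gt0.
(* The diagonal pairs contribute at most [n * H], half of what is allowed once [H] is at least
   [2 / eta ^+ 2]. The other half is for the finitely many pairs with [h != h'], covered by the
   induction hypothesis. *)
pose H := (Num.bound (eta ^+ 2 / 2)^-1).+1.
have HH : 1 <= eta ^+ 2 / 2 * H%:R.
  rewrite mulrC -ler_pdivrMr // mul1r; apply: ltW.
  apply: lt_trans (_ : (Num.bound (eta ^+ 2 / 2)^-1)%:R < _).
    by apply: archi_boundP; rewrite invr_ge0 ltW.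
  by rewrite ltr_nat.
have /boolp.choice[L hL] : forall p : 'I_H * 'I_H, exists L, forall M n, (L <= n)%N -> p.1 != p.2 ->
    \sum_(i < n) `|phi (w (M + i + p.1)%N - w (M + i + p.2)%N)| <= eta ^+ 2 / 2 * n%:R.
  case=> h h'; have [->|ne] := eqVneq h h'; first by exists 0%N => M n _ /eqP.
  have [L hL] := unif_null_norm (IH h h' ne) e20.
  by exists L => M n Ln _; exact: hL.
exists H => //; exists (\max_p L p) => M n Ln.
rewrite exchange_big /=.
apply: le_trans (_ : \sum_(h < H) (n%:R + eta ^+ 2 / 2 * n%:R * H%:R) <= _).
  apply: ler_sum => h _; rewrite exchange_big /= (bigD1 h) //= lerD //.
    apply: le_trans (_ : \sum_(i < n) 1 <= _); last by rewrite sumr_const card_ord.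
    by apply: ler_sum => i _; apply: le_trans (pd_norm_le _ pd) phi1.
  apply: le_trans (_ : \sum_(h' < H) (eta ^+ 2 / 2 * n%:R) <= _); last first.
    by rewrite sumr_const card_ord [leRHS]mulr_natr.
  rewrite [leRHS](bigD1 h) //= -[leLHS]add0r lerD ?mulr_ge0 ?(ltW eta0) //.
  apply: ler_sum => h' ne; apply: (hL (h, h')) => /=; last by rewrite eq_sym.
  by apply: leq_trans Ln; exact: leq_bigmax.
rewrite sumr_const card_ord -[_ *+ H]mulr_natr.
have n0 : 0 <= n%:R * H%:R :> R by rewrite mulr_ge0.
have : n%:R * H%:R * 1 <= n%:R * H%:R * (eta ^+ 2 / 2 * H%:R) by apply: ler_wpM2l.
lra.
Qed.

End VanDerCorput.

Local Open Scope classical_set_scope.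

(** * A shift-invariant mean on bounded sequences *)

Section Mean.
Variable R : realType.

Definition bdd (u : int -> R) : Prop := exists B, forall x, `|u x| <= B.

Definition cesaro (u : int -> R) (N : nat) : R := (\sum_(n < N.+1) u n%:Z) / N.+1%:R.

(** A Banach limit; [mean_cesaro] leads back from the mean to an actual average. *)
Record mean_on_bdd (L : (int -> R) -> R) : Prop := {
  meanD : forall u v, bdd u -> bdd v -> L (fun x => u x + v x) = L u + L v ;
  meanZ : forall a u, bdd u -> L (fun x => a * u x) = a * L u ;
  mean_cst : forall a, L (fun=> a) = a ;
  mean_ge0 : forall u, bdd u -> (forall x, 0 <= u x) -> 0 <= L u ;
  mean_shift1 : forall u, bdd u -> L (fun x => u (x + 1)) = L u ;
  mean_cesaro : forall u eps, bdd u -> L u < eps -> exists N, cesaro u N < eps }.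

Lemma cesaro_bound u B N : (forall x, `|u x| <= B) -> `|cesaro u N| <= B.
Proof.
move=> hB; rewrite /cesaro normrM normfV [X in _ / X]ger0_norm // ler_pdivrMr ?ltr0n //.
apply: le_trans (ler_norm_sum _ _ _) _.
apply: le_trans (_ : \sum_(n < N.+1) B <= _); first by apply: ler_sum.
by rewrite sumr_const card_ord mulr_natr.
Qed.

Lemma ultra_bdd_cvg (F : set_system nat) (f : nat -> R) B : UltraFilter F ->
  (forall n, `|f n| <= B) -> cvg (f @ F).
Proof.
move=> FU hB.
have PF : ProperFilter F := ultra_proper.
have FB : (f @ F) `[- B, B]%classic.
  by apply: (@filterE _ F) => n; rewrite /= in_itv /= -ler_norml; exact: hB.
have [p [_ clp]] := @segment_compact R (- B) B (f @ F) _ FB.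
apply/cvg_ex; exists p => V Vp.
have [//|/= FC] := in_ultra_setVsetC (f @^-1` V) FU.
have [x [] ] := clp (~` V) V FC Vp.
by [].
Qed.

(** The mean is the limit of the Cesaro averages along an ultrafilter refining [\oo]. *)
Lemma mean_exists : exists L, mean_on_bdd L.
Proof.
have [U [UU ooU]] := @ultraFilterLemma nat \oo _.
have PU : ProperFilter U := ultra_proper.
have cv u : bdd u -> cvg (cesaro u @ U).
  by move=> [B hB]; apply: (ultra_bdd_cvg (B := B)) => // N; exact: cesaro_bound.
exists (fun u => lim (cesaro u @ U)); split.
- move=> u v bu bv; rewrite -limD; [|exact: cv..]; congr (lim (_ @ U)).
  by apply/funext => N; rewrite /cesaro big_split mulrDl.
- move=> a u bu; apply: cvg_lim => //.
  rewrite (_ : cesaro _ = fun N => a * cesaro u N); last first.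
    by apply/funext => N; rewrite /cesaro -mulr_sumr -mulrA.
  by apply: cvgM; [exact: cvg_cst | exact: cv].
- move=> a; rewrite (_ : cesaro _ = cst a) ?lim_cst //.
  by apply/funext => N; rewrite /cesaro sumr_const card_ord -(mulr_natr a) mulfK ?pnatr_eq0.
- move=> u bu u0; apply: limr_ge; first exact: cv.
  by apply: filterE => N; rewrite /cesaro divr_ge0 // sumr_ge0.
- move=> u bu; have [B hB] := bu.
  have bu1 : bdd (fun x => u (x + 1)) by exists B.
  apply/eqP; rewrite -subr_eq0; apply/eqP; rewrite -limB; [|exact: cv..].
  apply: cvg_lim => //.
  (* A shift by one changes a Cesaro average only by its two end terms. *)
  have h0 : (fun N => (u N.+1%:Z - u 0) / N.+1%:R) @ \oo --> (0 : R).
    apply/cvgrPdist_lt => e e0.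
    near=> N; rewrite sub0r normrN normrM normfV [X in _ / X]ger0_norm // ltr_pdivrMr ?ltr0n //.
    apply: le_lt_trans (_ : B + B < _).
      by apply: le_trans (ler_normB _ _) _; rewrite lerD.
    rewrite -ltr_pdivrMl //.
    apply: lt_trans (_ : N%:R < _); last by rewrite ltr_nat.
    by near: N; exact: nbhs_infty_gtr.
  have -> : cesaro (fun x => u (x + 1)) - cesaro u = fun N => (u N.+1%:Z - u 0) / N.+1%:R.
    apply/funext => N; transitivity (cesaro (fun x => u (x + 1)) N - cesaro u N) => //.
    rewrite /cesaro -mulrBl; congr (_ / _); rewrite big_ord_recr big_ord_recl /=.
    under [X in _ - (_ + X)]eq_bigr do rewrite /bump /= addnC PoszD.
    rewrite (_ : N.+1%:Z = N%:Z + 1); last by lia.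
    by rewrite [u _ + \sum_(_ < _) _]addrC opprD addrACA subrr add0r.
  by move=> V Vp; apply: ooU; exact: h0.
- move=> u eps bu lt; have := cv u bu => /cvgrPdist_lt/(_ (eps - lim (cesaro u @ U))).
  rewrite subr_gt0 => /(_ lt) /filter_ex [N]; rewrite distrC => h; exists N.
  by move: (le_lt_trans (ler_norm _) h); rewrite ltrD2r.
Unshelve. all: by end_near. Qed.
End Mean.

Lemma subseq_nth2 (T : eqType) (x0 : T) (s : seq T) i j :
  (i < j)%N -> (j < size s)%N -> subseq [:: nth x0 s i; nth x0 s j] s.
Proof.
move=> ij js; rewrite -[s in X in subseq _ X](cat_take_drop j).
apply: (@cat_subseq _ [:: _] [:: _]); rewrite sub1seq.
  by rewrite -(nth_take x0 ij) mem_nth // size_takel // ltnW.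
by rewrite (drop_nth x0 js) mem_head.
Qed.

(** * Sums of totally bounded functions and an approximate Bessel inequality *)

Section TotallyBounded.
Variable R : realType.

(** Pairs are coloured by whether they are close for [q1]. A long homogeneous sequence contains one
    such pair, hence all its pairs are close for [q1], and some pair is also close for [q2]. *)
Lemma totally_boundedD (q1 q2 : int -> R) : totally_bounded q1 ->
  totally_bounded q2 -> totally_bounded (fun x => q1 x + q2 x).
Proof.
move=> h1 h2 delta d0; have d20 : 0 < delta / 2 by rewrite divr_gt0.
have [N1 hN1] := h1 _ d20; have [N2 hN2] := h2 _ d20.
have [r hr] := @ramsey int bool 2 (maxn N1 N2).
exists r => S szS.
pose col (s : seq int) := q1 (nth 0 s 1 - nth 0 s 0) < delta / 2.
have [H [sub sz [c hc]]] := hr S col szS.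
have [|a [b [subab ltab]]] := hN1 H; first by rewrite sz leq_maxl.
have [|a' [b' [subab' ltab']]] := hN2 H; first by rewrite sz leq_maxr.
exists a', b'; split; first exact: subseq_trans subab' sub.
have : col [:: a'; b'] by rewrite (hc [:: a'; b']) // -(hc [:: a; b]).
by rewrite /col /= => lt; rewrite [ltRHS]splitr ltrD.
Qed.

(* The centred vectors U^(x i) f - mean are almost orthogonal, so Bessel's
   inequality holds for them up to a bounded loss. *)
Lemma almost_bessel (phi : int -> R) n (x : 'I_n -> int) (z : int) (c eta : R) :
  posdef phi -> phi 0 <= 1 -> `|c| <= 1 -> 0 <= eta ->
  (forall i j, i != j -> `|phi (x i - x j) - c| <= eta) ->
  \sum_(i < n) \sum_(j < n) (phi (x i + z) - phi (x j + z)) ^+ 2 <=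
    2 * n%:R * (2 + eta * n%:R).
Proof.
move=> pd phi1 c1 eta0 hx.
case: (posnP n) => [n0|n0]; first by subst n; rewrite big_ord0 mulr0 mul0r.
have nR : 0 < n%:R :> R by rewrite ltr0n.
have sumc (a : R) : \sum_(i < n) a = n%:R * a by rewrite sumr_const card_ord mulr_natl.
pose F i := phi (x i + z); pose m := (\sum_(i < n) F i) / n%:R.
pose w i := F i - m; pose T := \sum_(i < n) w i ^+ 2.
have w0 : \sum_(i < n) w i = 0.
  by rewrite big_split /= sumc mulrN mulrC divfK ?gt_eqF ?subrr.
have -> : \sum_(i < n) \sum_(j < n) (phi (x i + z) - phi (x j + z)) ^+ 2 = 2 * n%:R * T.
  transitivity (\sum_(i < n) (n%:R * w i ^+ 2 + T)).
    apply: eq_bigr => i _.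
    transitivity (\sum_(j < n) (w i ^+ 2 + w j ^+ 2 - 2 * w i * w j)).
      by apply: eq_bigr => j _; rewrite /w /F; ring.
    by rewrite big_split big_split /= sumc sumrN -mulr_sumr w0 mulr0 subr0.
  by rewrite big_split /= sumc -mulr_sumr -/T; ring.
rewrite ler_pM2l ?mulr_gt0 //.
have T0 : 0 <= T by apply: sumr_ge0 => i _; rewrite sqr_ge0.
pose s := [seq (w i, x i) | i : 'I_n <- index_enum 'I_n].
have TE : T = \sum_(r <- s) r.1 * phi (r.2 + z).
  rewrite big_map /=; transitivity (\sum_(i < n) (w i ^+ 2 + m * w i)).
    by rewrite big_split /= -mulr_sumr w0 mulr0 addr0.
  by apply: eq_bigr => i _; rewrite /w /F; ring.
have := pd_cauchy_schwarz s z pd; rewrite -TE => cs.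
have {}cs : T ^+ 2 <= pd_form phi s.
  by apply: le_trans cs _; rewrite ler_piMl // pd_ge0.
(* Since the weights [w] sum to 0, the constant [c] can be subtracted from every entry. *)
have formE : pd_form phi s = \sum_(i < n) \sum_(j < n) w i * w j * (phi (x i - x j) - c).
  rewrite /pd_form big_map /=.
  under eq_bigr do rewrite big_map /=.
  under [RHS]eq_bigr do under eq_bigr do rewrite mulrBr.
  under [RHS]eq_bigr do rewrite big_split /=.
  rewrite [RHS]big_split /= -[LHS]addr0; congr (_ + _).
  under eq_bigr do (rewrite sumrN -mulr_suml -mulr_sumr w0 mulr0 mul0r oppr0).
  by rewrite big1.
(* Off the diagonal the entries are at most [eta], on it at most 2. The bound is a multiple of [T],
   and dividing [T ^+ 2] by [T] concludes. *)
have : pd_form phi s <= \sum_(i < n) \sum_(j < n)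
    ((w i ^+ 2 + w j ^+ 2) / 2 * (2 * (i == j)%:R + eta)).
  rewrite formE; apply: ler_sum => i _; apply: ler_sum => j _.
  apply: le_trans (ler_norm _) _; rewrite normrM ler_pM //.
    by rewrite -[w i ^+ 2]real_normK ?num_real // -[w j ^+ 2]real_normK ?num_real //
      normrM; have := sqr_ge0 (`|w i| - `|w j|); lra.
  have [<-|ne] := eqVneq i j; last by rewrite mulr0 add0r; exact: hx.
  rewrite mulr1; apply: le_trans (ler_normB _ _) _.
  by have := le_trans (pd_norm_le (x i - x i) pd) phi1; move: c1; lra.
have -> : \sum_(i < n) \sum_(j < n)
    ((w i ^+ 2 + w j ^+ 2) / 2 * (2 * (i == j)%:R + eta)) = (2 + eta * n%:R) * T.
  transitivity (\sum_(i < n) (2 * w i ^+ 2 + (n%:R * w i ^+ 2 + T) / 2 * eta)).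
    apply: eq_bigr => i _.
    transitivity (\sum_(j < n) ((w i ^+ 2 + w j ^+ 2) * (i == j)%:R +
        (w i ^+ 2 + w j ^+ 2) / 2 * eta)).
      by apply: eq_bigr => j _; field.
    rewrite big_split /= (bigD1 i) //= eqxx big1 ?addr0.
      by rewrite mulr1 -!mulr_suml big_split /= sumc; congr (_ + _); ring.
    by move=> j ne; rewrite eq_sym (negbTE ne) mulr0.
  rewrite big_split /= -mulr_sumr -/T -!mulr_suml big_split /= sumc -mulr_sumr -/T; by field.
move=> le; move: (le_trans cs le); rewrite expr2.
have [->|Tn0] := eqVneq T 0; first by rewrite addr_ge0 // mulr_ge0 // ltW.
by rewrite ler_pM2r // lt_def Tn0.
Qed.

End TotallyBounded.

(** * The autocorrelation of a positive definite sequence *)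

Section Decomposition.
Variables (R : realType) (L : (int -> R) -> R).
Hypothesis hL : mean_on_bdd L.

Lemma bddD (u v : int -> R) : bdd u -> bdd v -> bdd (fun x => u x + v x).
Proof.
move=> [B hB] [C hC]; exists (B + C) => x.
by apply: le_trans (ler_normD _ _) _; rewrite lerD.
Qed.

Lemma bddM (u v : int -> R) : bdd u -> bdd v -> bdd (fun x => u x * v x).
Proof.
move=> [B hB] [C hC]; exists (B * C) => x.
by rewrite normrM; apply: ler_pM.
Qed.

Lemma bdd_cst (a : R) : bdd (fun=> a).
Proof. by exists `|a|. Qed.

Lemma bdd_shift (u : int -> R) a : bdd u -> bdd (fun x => u (x + a)).
Proof. by move=> [B hB]; exists B. Qed.

Lemma bdd_sum I (r : seq I) (F : I -> int -> R) :
  (forall i, bdd (F i)) -> bdd (fun x => \sum_(i <- r) F i x).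
Proof.
move=> h; elim: r => [|i r IH].
  by rewrite (_ : (fun _ => _) = fun=> 0); [exact: bdd_cst | apply/funext => x; rewrite big_nil].
rewrite (_ : (fun _ => _) = fun x => F i x + \sum_(j <- r) F j x); first exact: bddD.
by apply/funext => x; rewrite big_cons.
Qed.

Lemma mean_sum I (r : seq I) (F : I -> int -> R) : (forall i, bdd (F i)) ->
  L (fun x => \sum_(i <- r) F i x) = \sum_(i <- r) L (F i).
Proof.
move=> h; elim: r => [|i r IH].
  rewrite big_nil -[RHS](mean_cst hL 0); congr L.
  by apply/funext => x; rewrite big_nil.
rewrite big_cons -IH -(meanD hL) //; last exact: bdd_sum.
by congr L; apply/funext => x; rewrite big_cons.
Qed.

Lemma mean_le (u v : int -> R) : bdd u -> bdd v -> (forall x, u x <= v x) -> L u <= L v.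
Proof.
move=> bu bv uv; rewrite -subr_ge0 -mulN1r -(meanZ hL) // -(meanD hL) //.
  apply: (mean_ge0 hL) => [|x]; last by rewrite mulN1r subr_ge0.
  by apply: bddD => //; apply: bddM => //; exact: bdd_cst.
by apply: bddM => //; exact: bdd_cst.
Qed.

Lemma mean_shift (u : int -> R) a : bdd u -> L (fun x => u (x + a)) = L u.
Proof.
have pos n (v : int -> R) : bdd v -> L (fun x => v (x + n%:Z)) = L v.
  move=> bv; elim: n => [|n IH]; first by congr L; apply/funext => x; rewrite addr0.
  rewrite -IH -[RHS](mean_shift1 hL); last exact: bdd_shift.
  by congr L; apply/funext => x; rewrite -addn1 PoszD addrA addrAC.
move=> bu; case: a => n; first exact: pos.
rewrite -(pos n.+1); last exact: bdd_shift.
by congr L; apply/funext => x; rewrite NegzE addrK.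
Qed.

(** In spectral terms, an atom of mass [a] of the spectral measure of a positive definite [phi]
    becomes an atom of mass [a ^+ 2], and the continuous part disappears. *)
Definition autocorr (phi : int -> R) (m : int) : R := L (fun n => phi (n + m) * phi n).

Section Autocorr.
Variable phi : int -> R.
Hypothesis pd : posdef phi.
Hypothesis phi1 : phi 0 <= 1.

Let bphi : bdd phi.
Proof. by exists (phi 0) => x; exact: pd_norm_le. Qed.

Lemma autocorrE a b : L (fun n => phi (n + a) * phi (n + b)) = autocorr phi (a - b).
Proof.
rewrite /autocorr -[RHS](mean_shift b); last by apply: bddM => //; exact: bdd_shift.
by congr L; apply/funext => n; congr (phi _ * _); ring.
Qed.

Lemma autocorr_form s :
  pd_form (autocorr phi) s = L (fun n => (\sum_(r <- s) r.1 * phi (r.2 + n)) ^+ 2).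
Proof.
have b2 (p r : R * int) : bdd (fun n => p.1 * r.1 * (phi (n + p.2) * phi (n + r.2))).
  by apply: bddM; [exact: bdd_cst | apply: bddM; exact: bdd_shift].
transitivity (L (fun n => \sum_(p <- s) \sum_(r <- s)
    p.1 * r.1 * (phi (n + p.2) * phi (n + r.2)))).
  rewrite mean_sum; last by move=> p; exact: bdd_sum.
  apply: eq_bigr => p _; rewrite mean_sum //; apply: eq_bigr => r _.
  by rewrite (meanZ hL) ?autocorrE //; apply: bddM; exact: bdd_shift.
congr L; apply/funext => n; rewrite expr2 mulr_suml; apply: eq_bigr => p _.
by rewrite mulr_sumr; apply: eq_bigr => r _; rewrite ![_ + n]addrC; ring.
Qed.

Let bform s : bdd (fun n => (\sum_(r <- s) r.1 * phi (r.2 + n)) ^+ 2).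
Proof.
have b1 : bdd (fun n => \sum_(r <- s) r.1 * phi (r.2 + n)).
  apply: bdd_sum => r; apply: bddM; first exact: bdd_cst.
  by exists (phi 0) => x; exact: pd_norm_le.
exact: (bddM b1 b1).
Qed.

Lemma autocorr_sym x : autocorr phi (- x) = autocorr phi x.
Proof.
rewrite -[- x]sub0r -autocorrE -[x in RHS]subr0 -autocorrE; congr L.
by apply/funext => n; rewrite mulrC.
Qed.

Lemma posdef_autocorr : posdef (autocorr phi).
Proof.
split=> [x|s]; first exact: autocorr_sym.
by rewrite autocorr_form; apply: (mean_ge0 hL) => // n; exact: sqr_ge0.
Qed.

(** By [autocorr_form] the form of the autocorrelation is a mean of squares, each of which is at
    most the form of [phi] by Cauchy-Schwarz and [phi 0 <= 1]. *)
Lemma posdef_sub_autocorr : posdef (fun x => phi x - autocorr phi x).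
Proof.
split=> [x|s]; first by rewrite pd_sym // autocorr_sym.
rewrite (_ : (fun x => _) = fun x => phi x + -1 * autocorr phi x); last first.
  by apply/funext => x; rewrite mulN1r.
rewrite pd_formD pd_formZ mulN1r subr_ge0 autocorr_form.
rewrite -[leRHS](mean_cst hL); apply: mean_le => //; first exact: bdd_cst.
move=> n; apply: le_trans (pd_cauchy_schwarz _ _ pd) _.
by rewrite ler_piMl // pd_ge0.
Qed.

(** Ramsey's theorem, with pairs coloured by the approximate value of [phi (b - a)], gives points
    that are almost equicorrelated. [almost_bessel] bounds the sum of squared differences of their
    translates; the mean of that sum would exceed the bound if all pairs were [delta]-separated. *)
Lemma totally_bounded_autocorr :
  totally_bounded (fun x => autocorr phi 0 - autocorr phi x).
Proof.
move=> delta d0; pose eta := delta / 2.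
have eta0 : 0 < eta by rewrite divr_gt0.
(* Large enough for [hn], the inequality that separates the two estimates in the final
   contradiction. *)
pose n := (Num.bound (4 / delta)).+3.
have nR : 0 < n%:R :> R by rewrite ltr0n.
have hn : 2 + eta * n%:R < delta * (n%:R - 1).
  have : 4 / delta < (Num.bound (4 / delta))%:R by apply: archi_boundP; rewrite divr_ge0 // ltW.
  rewrite ltr_pdivrMr // /eta /n -addn3 natrD; lra.
pose K := (Num.bound (2 / eta)).+1.
(* The interval from -1 to 1 is cut into cells of width [eta]. *)
pose key (y : R) : 'I_K := inord `|Num.floor ((y + 1) / eta)|%N.
have keyP y y' : `|y| <= 1 -> `|y'| <= 1 -> key y = key y' -> `|y - y'| <= eta.
  have fl t : `|t| <= 1 -> key t%R = `|Num.floor ((t + 1) / eta)|%N :> nat /\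
      (`|Num.floor ((t + 1) / eta)|%N%:R : R) = (Num.floor ((t + 1) / eta))%:~R.
    rewrite ler_norml => /andP[t1 t2].
    have f0 : 0 <= Num.floor ((t + 1) / eta).
      by rewrite floor_ge0 divr_ge0 ?(ltW eta0) //; lra.
    have fE : (`|Num.floor ((t + 1) / eta)|%N%:R : R) = (Num.floor ((t + 1) / eta))%:~R.
      by rewrite natr_absz ger0_norm.
    split=> //; rewrite /key inordK // ltnS ltnW // -(ltr_nat R) fE.
    apply: le_lt_trans (floor_le_tmp _) _.
    apply: le_lt_trans (_ : 2 / eta < _); last by apply: archi_boundP; rewrite divr_ge0 // ltW.
    by rewrite ler_pM2r ?invr_gt0 //; lra.
  move=> hy hy'; have [k1 f1] := fl y hy; have [k2 f2] := fl y' hy'.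
  move=> kk; have : (Num.floor ((y + 1) / eta))%:~R = (Num.floor ((y' + 1) / eta))%:~R :> R.
    by rewrite -f1 -f2 -k1 -k2 kk.
  have := floorD1_gt ((y + 1) / eta); have := floorD1_gt ((y' + 1) / eta).
  have := floor_le_tmp ((y + 1) / eta); have := floor_le_tmp ((y' + 1) / eta).
  rewrite !intrD; set a := (_%:~R); set b := (_%:~R) => h1 h2 h3 h4 ab.
  have : `|(y + 1) / eta - (y' + 1) / eta| <= 1.
    by rewrite ler_norml; apply/andP; split; lra.
  rewrite -mulrBl normrM normfV [X in _ / X]gtr0_norm // ler_pdivrMr // mul1r.
  by rewrite opprD addrACA subrr addr0.
have [r hr] := @ramsey int 'I_K 2 n.
exists r => S szS; apply: contrapT => nex.
pose col (s : seq int) := key (phi (nth 0 s 1 - nth 0 s 0)).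
have [H [sub sz [c hc]]] := hr S col szS.
have sep a b : subseq [:: a; b] H -> delta <= autocorr phi 0 - autocorr phi (b - a).
  move=> ab; rewrite leNgt; apply/negP => lt; apply: nex; exists a, b; split => //.
  exact: subseq_trans ab sub.
pose x (i : 'I_n) := nth 0 H i.
have subx (i j : 'I_n) : (i < j)%N -> subseq [:: x i; x j] H.
  by move=> ij; apply: subseq_nth2; rewrite ?sz.
have phix (i j : 'I_n) : `|phi (x i - x j)| <= 1 by apply: le_trans (pd_norm_le _ pd) phi1.
have kx (i j : 'I_n) : i != j -> key (phi (x i - x j)) = c.
  rewrite -val_eqE neq_ltn => /orP[] /subx ij; rewrite -(hc _ ij) // /col /=.
  by rewrite pd_symB.
pose i0 : 'I_n := ord0; pose i1 : 'I_n := Ordinal (isT : (1 < n)%N).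
pose c0 := phi (x i0 - x i1).
have hb z : \sum_(i < n) \sum_(j < n) (phi (x i + z) - phi (x j + z)) ^+ 2 <=
    2 * n%:R * (2 + eta * n%:R).
  apply: (@almost_bessel _ _ _ _ _ c0) => //; first exact: phix.
    exact: ltW.
  by move=> i j ij; apply: keyP; rewrite ?phix // !kx.
have bsh (i : 'I_n) : bdd (fun z => phi (x i + z)).
  by exists (phi 0) => z; exact: pd_norm_le.
have bdf (i j : 'I_n) : bdd (fun z => (phi (x i + z) - phi (x j + z)) ^+ 2).
  have b1 : bdd (fun z => phi (x i + z) + -1 * phi (x j + z)).
    by apply: bddD => //; apply: bddM => //; exact: bdd_cst.
  have := bddM b1 b1; congr bdd; apply/funext => z; ring.
have Ldf (i j : 'I_n) : L (fun z => (phi (x i + z) - phi (x j + z)) ^+ 2) =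
    2 * (autocorr phi 0 - autocorr phi (x i - x j)).
  transitivity (pd_form (autocorr phi) [:: (1, x i); (-1, x j)]).
    rewrite autocorr_form; congr L; apply/funext => z.
    by rewrite !big_cons big_nil /=; ring.
  rewrite !pd_form_cons ?pd_form_nil ?big_cons ?big_nil /=; try exact: posdef_autocorr.
  by rewrite (pd_symB _ _ posdef_autocorr); ring.
have : L (fun z => \sum_(i < n) \sum_(j < n) (phi (x i + z) - phi (x j + z)) ^+ 2) <=
    2 * n%:R * (2 + eta * n%:R).
  rewrite -[leRHS](mean_cst hL); apply: mean_le => //; last exact: bdd_cst.
  by apply: bdd_sum => i; exact: bdd_sum.
rewrite mean_sum; last by move=> i; exact: bdd_sum.
apply/negP; rewrite -ltNge.
apply: lt_le_trans (_ : \sum_(i < n) (2 * delta * (n%:R - 1)) <= _).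
  rewrite sumr_const card_ord -[_ *+ n]mulr_natl.
  by move: hn; rewrite -(ltr_pM2l nR); lra.
apply: ler_sum => i _; rewrite mean_sum // (bigD1 i) //=.
apply: le_trans (_ : \sum_(j < n | j != i) 2 * delta <= _).
  rewrite sumr_const cardC1 card_ord.
  have <- : n.-1%:R + 1 = n%:R :> R by rewrite natr1.
  by rewrite addrK mulr_natr.
rewrite -[leLHS]add0r lerD //; first by apply: (mean_ge0 hL) => // z; exact: sqr_ge0.
apply: ler_sum => j ji; rewrite Ldf ler_pM2l //.
by case: (ltngtP i j) ji => [ij|ij|/val_inj ->] ji; rewrite ?eqxx // in ji *;
  [rewrite (pd_symB _ _ posdef_autocorr)|]; apply: sep; apply: subx.
Qed.
End Autocorr.
End Decomposition.

(** * Iterated subtraction of the autocorrelation and its limit *)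

Lemma posdef0 (R : realType) : posdef (fun=> 0 : R).
Proof.
split=> // s; rewrite /pd_form big1 // => p _.
by rewrite big1 // => r _; rewrite mulr0.
Qed.

Lemma posdef_lim (R : realType) (u : nat -> int -> R) (v : int -> R) :
  (\forall k \near \oo, posdef (u k)) -> (forall x, u k x @[k --> \oo] --> v x) -> posdef v.
Proof.
move=> pdu cv; split=> [x|s].
  have h : (fun k => u k (- x) - u k x) @ \oo --> v (- x) - v x by apply: cvgB.
  apply/eqP; rewrite -subr_eq0; apply/eqP.
  rewrite -(cvg_lim (@Rhausdorff R) h); apply: cvg_lim => //.
  apply: cvg_near_cst; near=> k; rewrite pd_sym ?subrr //; near: k; exact: pdu.
have h : (fun k => pd_form (u k) s) @ \oo --> pd_form v s.
  apply: cvg_big => [|p _]; first exact: add_continuous.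
  apply: cvg_big => [|r _]; first exact: add_continuous.
  by apply: cvgM; [exact: cvg_cst | exact: cv].
rewrite -(cvg_lim (@Rhausdorff R) h); apply: limr_ge; first by apply/cvg_ex; eexists; exact: h.
by apply: filterS pdu => k /pd_ge0.
Unshelve. all: by end_near. Qed.

Section Decomposition.
Variables (R : realType) (L : (int -> R) -> R).
Hypothesis hL : mean_on_bdd L.
Variable phi : int -> R.
Hypothesis pd : posdef phi.
Hypothesis phi1 : phi 0 <= 1.

Definition residue (k : nat) : int -> R :=
  iter k (fun f x => f x - autocorr L f x) phi.

Lemma residueS k x : residue k.+1 x = residue k x - autocorr L (residue k) x.
Proof. by []. Qed.

Lemma posdef_residue k : posdef (residue k) /\ residue k 0 <= 1.
Proof.
elim: k => [//|k [IH1 IH2]]; split; first exact: posdef_sub_autocorr.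
rewrite residueS; apply: le_trans IH2; rewrite gerBl.
exact/pd0_ge0/posdef_autocorr.
Qed.

Lemma posdef_residueB k j : (k <= j)%N -> posdef (fun x => residue k x - residue j x).
Proof.
move=> /subnKC <-; elim: (j - k)%N => [|i IH].
  rewrite addn0 (_ : (fun _ => _) = fun=> 0); first exact: posdef0.
  by apply/funext => x; rewrite subrr.
have [h1 h2] := posdef_residue (k + i).
have := posdefD IH (posdef_autocorr hL h1).
by congr posdef; apply/funext => x; rewrite addnS residueS opprB addrA addrAC.
Qed.

Lemma residue_le k j x : (k <= j)%N ->
  `|residue k x - residue j x| <= residue k 0 - residue j 0.
Proof. by move=> /posdef_residueB /(pd_norm_le x). Qed.

(** Differences of residues are positive definite, so [residue k 0 + e * residue k x] is
    nonincreasing and nonnegative for [e] = 0 and 1; the residue at [x] is the difference of these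
    two convergent sequences. *)
Lemma cvg_residue x : cvg (residue k x @[k --> \oo]).
Proof.
have cv (e : R) : `|e| <= 1 -> cvg ((residue k 0 + e * residue k x) @[k --> \oo]).
  move=> e1; apply: nonincreasing_is_cvgn => [k j kj|].
    have := residue_le x kj; rewrite -subr_ge0 => h.
    have : `|e * (residue k x - residue j x)| <= `|residue k x - residue j x|.
      by rewrite normrM ler_piMl.
    rewrite ler_norml => /andP[]; lra.
  exists 0 => _ [k _ <-]; have [h _] := posdef_residue k.
  have : `|e * residue k x| <= `|residue k x| by rewrite normrM ler_piMl.
  by rewrite ler_norml => /andP[]; have := pd_norm_le x h; lra.
have c0 := cv 0; have c1 := cv 1.
rewrite (_ : (fun k => residue k x) = fun k =>
  (residue k 0 + 1 * residue k x) - (residue k 0 + 0 * residue k x)).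
  by apply: is_cvgB; [apply: c1; rewrite normr1|apply: c0; rewrite normr0].
by apply/funext => k; ring.
Qed.

Definition residue_lim (x : int) : R := lim (residue k x @[k --> \oo]).

Lemma residue_cvg_to x : residue k x @[k --> \oo] --> residue_lim x.
Proof. exact: cvg_residue. Qed.

Lemma posdef_residue_lim : posdef residue_lim.
Proof.
apply: (posdef_lim _ residue_cvg_to); apply: filterE => k.
by have [] := posdef_residue k.
Qed.

Lemma posdef_sub_residue_lim k : posdef (fun x => residue k x - residue_lim x).
Proof.
apply: (@posdef_lim _ (fun j x => residue k x - residue j x)).
  by near=> j; apply: posdef_residueB; near: j; exact: nbhs_infty_ge.
by move=> x; apply: cvgB; [exact: cvg_cst | exact: residue_cvg_to].
Unshelve. all: by end_near. Qed.

Lemma totally_bounded_residueB k :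
  totally_bounded (fun x => (phi 0 - residue k 0) - (phi x - residue k x)).
Proof.
elim: k => [|k IH].
  move=> delta d0; exists 2%N => -[|a [|b S]] // _; exists a, b; split.
    by rewrite /= !eqxx sub0seq.
  by rewrite /residue /= !subrr.
have [h1 h2] := posdef_residue k.
have := totally_boundedD IH (totally_bounded_autocorr hL h1 h2).
by congr totally_bounded; apply/funext => x; rewrite !residueS; ring.
Qed.

(** A positive definite function is largest at 0, so convergence at 0 is uniform convergence. One
    third of [delta] goes to the finite stage, the others to the errors at 0 and at [b - a]. *)
Lemma totally_bounded_sub_lim :
  totally_bounded (fun x => (phi 0 - residue_lim 0) - (phi x - residue_lim x)).
Proof.
move=> delta d0; have d30 : 0 < delta / 3 by rewrite divr_gt0.
have [k hk] : exists k, residue k 0 - residue_lim 0 < delta / 3.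
  have /cvgrPdist_lt/(_ _ d30)/filter_ex [k hk] := residue_cvg_to (x := 0).
  by exists k; apply: le_lt_trans (ler_norm _) _; rewrite distrC.
have [N hN] := totally_bounded_residueB k d30.
exists N => S /hN [a [b [sub lt]]]; exists a, b; split => //.
have := pd_norm_le (b - a) (posdef_sub_residue_lim k).
rewrite ler_norml => /andP[]; lra.
Qed.

(** The mean of the square of [residue k] is its autocorrelation at 0, that is the decrement
    [residue k 0 - residue k.+1 0], which tends to 0; uniform convergence carries this to the
    limit. *)
Lemma mean_residue_lim_sq : L (fun x => residue_lim x ^+ 2) = 0.
Proof.
have blim : bdd residue_lim.
  by exists (residue_lim 0) => x; exact: (pd_norm_le _ posdef_residue_lim).
have blim2 : bdd (fun x => residue_lim x ^+ 2) by exact: (bddM blim blim).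
have t0 k : residue_lim 0 <= residue k 0.
  by rewrite -subr_ge0; exact: (pd0_ge0 (posdef_sub_residue_lim k)).
apply/eqP; rewrite eq_le (mean_ge0 hL) ?andbT //; last by move=> x; exact: sqr_ge0.
apply/ler_addgt0Pr => e e0; rewrite add0r.
have e30 : 0 < e / 3 by rewrite divr_gt0.
have /cvgrPdist_lt/(_ _ e30)/filter_ex [k hk] := residue_cvg_to (x := 0).
have {}hk : residue k 0 - residue_lim 0 < e / 3.
  by apply: le_lt_trans (ler_norm _) _; rewrite distrC.
have [h1 h2] := posdef_residue k.
have bk : bdd (residue k) by exists (residue k 0) => x; exact: pd_norm_le.
have le x : residue_lim x ^+ 2 <= residue k (x + 0) * residue k x + 2 * (e / 3).
  have a1 := le_trans (pd_norm_le x h1) h2.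
  have a2 := le_trans (le_trans (pd_norm_le x posdef_residue_lim) (t0 k)) h2.
  have a3 := le_lt_trans (pd_norm_le x (posdef_sub_residue_lim k)) hk.
  rewrite addr0 -subr_ge0.
  have a4 : `|(residue k x - residue_lim x) * (residue k x + residue_lim x)| <= e / 3 * 2.
    rewrite normrM ler_pM // ?(ltW a3) //.
    by apply: le_trans (ler_normD _ _) _; lra.
  by move: a4; rewrite ler_norml => /andP[]; lra.
apply: le_trans (_ : L (fun x => residue k (x + 0) * residue k x + 2 * (e / 3)) <= _).
  apply: (mean_le hL) => //; apply: bddD; last exact: bdd_cst.
  by apply: bddM => //; exact: bdd_shift.
rewrite (meanD hL) ?(mean_cst hL); [|by apply: bddM => //; exact: bdd_shift|exact: bdd_cst].
have -> : L (fun x => residue k (x + 0) * residue k x) = residue k 0 - residue k.+1 0.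
  by rewrite residueS opprB addrC subrK.
have := t0 k.+1; lra.
Qed.

End Decomposition.

Theorem posdef_decomposition (R : realType) (phi : int -> R) :
  posdef phi -> phi 0 <= 1 -> exists psi chi : int -> R,
  [/\ forall x, phi x = psi x + chi x,
      posdef psi /\ totally_bounded (fun x => psi 0 - psi x),
      posdef chi, chi 0 <= 1 &
      forall eps, 0 < eps -> exists2 N, (0 < N)%N &
        \sum_(n < N) chi n%:Z ^+ 2 <= eps * N%:R].
Proof.
move=> pd phi1; have [L hL] := mean_exists R.
pose chi := residue_lim L phi.
have pdchi : posdef chi := posdef_residue_lim hL pd phi1.
(* The residue of index 0 is [phi] itself. *)
have pdpsi : posdef (fun x => phi x - chi x) := posdef_sub_residue_lim hL pd phi1 0.
exists (fun x => phi x - chi x), chi; split => //.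
- by move=> x; rewrite subrK.
- by split => //; exact: totally_bounded_sub_lim.
- by apply: le_trans phi1; rewrite -subr_ge0; exact: (pd0_ge0 pdpsi).
move=> eps e0.
have bchi : bdd chi by exists (chi 0) => x; exact: pd_norm_le.
have [|N hN] := mean_cesaro hL (u := fun x => chi x ^+ 2) (eps := eps) (bddM bchi bchi).
  by rewrite (mean_residue_lim_sq hL).
by exists N.+1 => //; apply: ltW; rewrite -ltr_pdivrMr ?ltr0n.
Qed.

(** * Integer-valued polynomials: differences and denominators *)

Lemma coef_XaddC_expn (R : comNzRingType) (c : R) i n :
  (('X + c%:P) ^+ i)`_n = c ^+ (i - n) *+ 'C(i, n).
Proof.
have -> : ('X + c%:P) ^+ i = \poly_(j < i.+1) (c ^+ (i - j) *+ 'C(i, j)).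
  rewrite poly_def addrC exprDn; apply: eq_bigr => j _.
  by rewrite -polyC_exp mul_polyC scalerMnl.
by rewrite coef_poly; case: ltnP => // lt; rewrite bin_small.
Qed.

Lemma coef_comp_XaddC (R : comNzRingType) (p : {poly R}) (c : R) n :
  (p \Po ('X + c%:P))`_n = \sum_(i < size p) p`_i * (c ^+ (i - n) *+ 'C(i, n)).
Proof. by rewrite coef_comp_poly; apply: eq_bigr => i _; rewrite coef_XaddC_expn. Qed.

(** The top coefficients cancel, and the next one is the leading coefficient of [p] times the degree
    times [c - c']. *)
Lemma size_comp_XaddC_sub (R : numDomainType) (p : {poly R}) (c c' : R) :
  c != c' -> (2 < size p)%N ->
  size ((p \Po ('X + c%:P)) - (p \Po ('X + c'%:P))) = (size p).-1.
Proof.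
move=> cc' szp; case E : (size p) szp => [|[|m]] //= szp.
have coefE n : ((p \Po ('X + c%:P)) - (p \Po ('X + c'%:P)))`_n =
    \sum_(i < m.+2) p`_i * ((c ^+ (i - n) - c' ^+ (i - n)) *+ 'C(i, n)).
  rewrite coefB !coef_comp_XaddC E -sumrB; apply: eq_bigr => i _.
  by rewrite -mulrBr mulrnBl.
apply/eqP; rewrite eqn_leq; apply/andP; split.
  apply/leq_sizeP => n mn; rewrite coefE big1 // => i _.
  have [->|ne] := eqVneq (i : nat) n; first by rewrite subnn !expr0 subrr mul0rn mulr0.
  by rewrite bin_small ?mulr0 //; have := ltn_ord i; lia.
rewrite ltnNge; apply/negP => /leq_sizeP /(_ m (leqnn m)); rewrite coefE.
rewrite big_ord_recr big_ord_recr /= big1 ?add0r; last first.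
  by move=> i _; rewrite bin_small ?mulr0 //; have := ltn_ord i; lia.
rewrite subnn !expr0 subrr mul0rn mulr0 add0r subSnn !expr1 binSn.
move/eqP; rewrite mulf_eq0 mulrn_eq0 /= subr_eq0 (negbTE cc') orbF.
have := lead_coef_eq0 p; rewrite /lead_coef E /= => ->.
by rewrite -size_poly_eq0 E.
Qed.

Lemma nonconst_polyP (R : realType) (p : {poly R}) (w : nat -> int) :
  (1 < size p)%N -> (forall n, (w n)%:~R = p.[n%:R]) -> nonconst_poly w.
Proof.
case E : (size p) => [|[|d]] // _; elim: d p w E => [|d IH] p w szp wE.
  have pE x : p.[x] = p`_0 + p`_1 * x.
    by rewrite horner_coef szp !big_ord_recl big_ord0 /= expr0 mulr1 expr1 addr0.
  apply: (@nonconst_affine (w 1%N - w 0%N) (w 0%N)).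
    rewrite -(intr_eq0 R) intrB !wE !pE mulr0 mulr1 addr0 addrAC subrr add0r.
    have := lead_coef_eq0 p; rewrite /lead_coef szp /= => ->.
    by rewrite -size_poly_eq0 szp.
  move=> n; apply: (intr_inj (R := R)); rewrite intrD intrM intrB !wE !pE -pmulrn.
  ring.
apply: nonconst_diff => h h' hh'.
apply: (IH ((p \Po ('X + h%:R%:P)) - (p \Po ('X + h'%:R%:P)))).
  by rewrite size_comp_XaddC_sub ?szp // eqr_nat.
by move=> n; rewrite intrB !wE hornerD hornerN !horner_comp !hornerE !natrD.
Qed.

(** Newton interpolation: the divided difference of [p] at [k] has smaller degree and takes rational
    values at the remaining points. *)
Lemma ratr_poly_of_values (R : realType) (p : {poly R}) n k : (size p <= n)%N ->
  (forall i, (k <= i < k + n)%N -> exists q : rat, p.[i%:R] = ratr q) ->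
  exists p' : {poly rat}, p = map_poly ratr p'.
Proof.
elim: n p k => [|n IH] p k szp hp.
  by exists 0; rewrite rmorph0; apply/eqP; rewrite -size_poly_leq0.
have [c hc] := hp k ltac:(lia).
have /factor_theorem[q qE] : root (p - p.[k%:R]%:P) k%:R.
  by rewrite rootE !hornerE subrr.
have pE : p = q * ('X - k%:R%:P) + p.[k%:R]%:P by rewrite -qE subrK.
have [|i /andP[ki ikn]|q' q'E] := IH q k.+1.
- have [->|q0] := eqVneq q 0; first by rewrite size_poly0.
  have : (size (q * ('X - k%:R%:P))%R <= n.+1)%N.
    rewrite -qE (leq_trans (size_polyD _ _)) // geq_max szp size_polyN.
    by rewrite (leq_trans (size_polyC_leq1 _)).
  by rewrite size_Mmonic ?monicXsubC // size_XsubC addn2 /=.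
- have [ci hci] := hp i ltac:(lia).
  exists ((ci - c) / (i%:R - k%:R)).
  have ik : i%:R - k%:R != 0 :> R by rewrite subr_eq0 eqr_nat; lia.
  apply: (mulIf ik); rewrite !rmorphM fmorphV !rmorphB /= !ratr_nat mulfVK //.
  have pi : p.[i%:R] = q.[i%:R] * (i%:R - k%:R) + p.[k%:R] by rewrite {1}pE !hornerE.
  by rewrite -hc -hci pi addrK.
exists (q' * ('X - k%:R%:P) + c%:P).
by rewrite rmorphD rmorphM rmorphB /= map_polyX !map_polyC /= ratr_nat -q'E -hc.
Qed.

Lemma odd_poly_horner (R : realType) l (a : nat -> R) x :
  (odd_poly_of l a).[x] = \sum_(1 <= j < l.+1) a j * x ^+ (2 * j - 1).
Proof. by rewrite /odd_poly_of horner_sum; apply: eq_bigr => j _; rewrite !hornerE. Qed.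

Lemma odd_poly_coef (R : realType) l (a : nat -> R) j : (1 <= j < l.+1)%N ->
  (odd_poly_of l a)`_(2 * j - 1) = a j.
Proof.
move=> jl; rewrite /odd_poly_of coef_sum (bigD1_seq j) ?mem_index_iota ?iota_uniq //=.
rewrite coefZ coefXn eqxx mulr1 big_seq_cond big1 ?addr0 // => i /andP[].
rewrite mem_index_iota => il ij; rewrite coefZ coefXn.
by rewrite (_ : _ == _ = false) ?mulr0 //; lia.
Qed.

Lemma odd_poly_denominator (R : realType) l (a : nat -> R) (w : int -> int) :
  (forall z, (w z)%:~R = (odd_poly_of l a).[z%:~R]) ->
  exists D : nat, (0 < D)%N /\ exists b : nat -> int,
    forall z, D%:Z * w z = \sum_(1 <= j < l.+1) b j * z ^+ (2 * j - 1).
Proof.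
move=> wE; have [i _|p' p'E] := @ratr_poly_of_values R (odd_poly_of l a) _ 0 (leqnn _).
  by exists (w i)%:~R; rewrite ratr_int wE.
have [q [c c0 qE]] := rat_poly_scale p'.
have coefE i : c%:~R * (odd_poly_of l a)`_i = (q`_i)%:~R.
  rewrite p'E qE coef_map /= coefZ coef_map /= rmorphM /= fmorphV /= !ratr_int.
  by rewrite mulVKf // intr_eq0.
exists `|c|%N; split; first by rewrite absz_gt0.
(* The common denominator [c] may be negative; its sign moves into the coefficients. *)
exists (fun j => Num.sg c * q`_(2 * j - 1)) => z.
rewrite abszE normrEsg -mulrA.
have -> : c * w z = \sum_(1 <= j < l.+1) q`_(2 * j - 1) * z ^+ (2 * j - 1).
  apply: (intr_inj (R := R)); rewrite intrM wE odd_poly_horner mulr_sumr rmorph_sum /=.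
  rewrite big_nat [RHS]big_nat; apply: eq_bigr => j jl.
  by rewrite intrM -coefE odd_poly_coef // mulrA rmorphXn.
by rewrite mulr_sumr; apply: eq_bigr => j _; rewrite mulrA.
Qed.

(** * From uniform averages to upper Banach density *)

Section Density.
Variable R : realType.

(** Markov's inequality on each interval: [c] times the number of elements of [E] is at most the sum
    of [u]. *)
Lemma upper_banach_density0 (u : nat -> R) (c : R) (E : set nat) : 0 < c ->
  (forall n, 0 <= u n) -> (forall n, n \in E -> c <= u n) -> unif_null u ->
  upper_banach_density R E = 0%E.
Proof.
move=> c0 u0 hE hu; apply/eqP; rewrite eq_le; apply/andP; split.
  apply/lee_addgt0Pr => e e0; rewrite add0e.
  have [L hL] := hu (e * c) (mulr_gt0 e0 c0).
  apply: (@le_trans _ _ (ereal_sup [set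
    ((\sum_(MN.1.+1 <= k < MN.2.+1 | k \in E) 1)%N%:R / (MN.2 - MN.1)%N%:R)%:E |
    MN in [set MN : nat * nat | (MN.1 + L.+1 <= MN.2)%N]] : \bar R)).
    apply: ereal_inf_lbound; exists [set MN : nat * nat | (MN.1 + L.+1 <= MN.2)%N] => //.
    by exists L.+1.
  apply: ge_ereal_sup => _ [[M N] /= MN <-]; rewrite lee_fin.
  rewrite ler_pdivrMr ?ltr0n; last by lia.
  rewrite -(ler_pM2r c0) mulrAC.
  have LN : (L <= N - M)%N by lia.
  apply: le_trans (hL M.+1 _ LN); rewrite natr_sum mulr_suml.
  rewrite -(big_mkord xpredT (fun i => u (M.+1 + i)%N)).
  have -> : \sum_(0 <= i < N - M) u (M.+1 + i)%N = \sum_(M.+1 <= k < N.+1) u k.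
    by rewrite -{2}[M.+1]add0n big_addn subSS; apply: eq_bigr => i _; rewrite addnC.
  rewrite big_mkcond /=; apply: ler_sum => k _; case: ifP => [/hE|_] //.
  by rewrite mul1r.
(* For the lower bound, every set of the filter contains some pair [(0, L)], whose quotient is
   nonnegative. *)
apply: le_ereal_inf_tmp => _ [V [L _ LV] <-].
apply: (@le_trans _ _ (((\sum_(1 <= k < L.+1 | k \in E) 1)%N%:R / (L - 0)%N%:R)%:E : \bar R)).
  by rewrite lee_fin divr_ge0.
by apply: ereal_sup_ubound; exists (0%N, L) => //; apply: LV => /=; rewrite add0n.
Qed.

End Density.

(** * Integer iterates and correlations of a measure preserving map *)

Section Iterz.
Variables (X : Type) (T Tinv : X -> X).
Hypotheses (TK : cancel T Tinv) (TinvK : cancel Tinv T).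

Lemma iterz_succ z x : iterz T Tinv (z + 1) x = T (iterz T Tinv z x).
Proof.
case: z => n; first by rewrite -PoszD addn1.
case: n => [|n]; first by rewrite /= TinvK.
by rewrite (_ : Negz n.+1 + 1 = Negz n) ?NegzE /= ?TinvK //; lia.
Qed.

Lemma iterz_add a b x : iterz T Tinv (a + b) x = iterz T Tinv a (iterz T Tinv b x).
Proof.
have pos n y c : iterz T Tinv (n%:Z + c) y = iter n T (iterz T Tinv c y).
  elim: n => [|n IH]; first by rewrite add0r.
  by rewrite (_ : n.+1%:Z + c = n%:Z + c + 1) ?iterz_succ ?IH //; lia.
case: a => n; first exact: pos.
have iterK m : cancel (iter m T) (iter m Tinv).
  by elim: m => // m IH y; rewrite iterSr iterS TK IH.
by rewrite -[LHS](iterK n.+1) -pos NegzE addNKr.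
Qed.

End Iterz.

Section Correlation.
Variables (d : measure_display) (X : measurableType d) (R : realType).
Variables (mu : probability X R) (T Tinv : X -> X).
Hypothesis hT : invertible_mps mu T Tinv.

Lemma measurable_iterz z : measurable_fun [set: X] (iterz T Tinv z).
Proof.
have it (S : X -> X) n : measurable_fun [set: X] S -> measurable_fun [set: X] (iter n S).
  move=> mS; elim: n => [|n IH]; first exact: measurable_id.
  exact: (measurableT_comp mS IH).
by case: z => n; apply: it; [exact: mps_measurable hT|exact: mps_measurable_inv hT].
Qed.

Lemma measurable_preimage (S : X -> X) B : measurable_fun [set: X] S ->
  measurable B -> measurable (S @^-1` B).
Proof. by move=> mS mB; rewrite -[_ @^-1` _]setTI; apply: mS. Qed.

Lemma preserving_iterz z B : measurable B -> mu (iterz T Tinv z @^-1` B) = mu B.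
Proof.
have it (S : X -> X) : measurable_fun [set: X] S ->
    (forall C, measurable C -> mu (S @^-1` C) = mu C) ->
    forall n C, measurable C -> mu (iter n S @^-1` C) = mu C.
  move=> mS hS; elim=> // n IH C mC.
  transitivity (mu (iter n S @^-1` (S @^-1` C))) => //.
  by rewrite IH ?hS //; exact: measurable_preimage.
case: z => n; apply: it; [exact: mps_measurable hT|exact: mps_preserving hT|
  exact: mps_measurable_inv hT|] => C mC.
rewrite -(mps_preserving hT); last exact: measurable_preimage (mps_measurable_inv hT) mC.
by congr (mu _); apply/seteqP; split => x /=; rewrite (mps_cancel hT).
Qed.

(** Integrability travels together with the value, so that finite sums need only one induction. *)
Definition integral_is (f : X -> R) (v : R) : Prop :=
  mu.-integrable [set: X] (EFin \o f) /\ \int[mu]_x f x = v.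

Lemma integral_isD f g v w : integral_is f v -> integral_is g w ->
  integral_is (fun x => f x + g x) (v + w).
Proof.
move=> [if_ <-] [ig <-]; split; last by rewrite RintegralD.
exact: integrableD if_ ig.
Qed.

Lemma integral_isZ a f v : integral_is f v -> integral_is (fun x => a * f x) (a * v).
Proof.
move=> [if_ <-]; split; last by rewrite RintegralZl.
exact: (integrableZl _ a if_).
Qed.

Lemma integral_is_cst a : integral_is (fun=> a) a.
Proof.
split; first exact: (finite_measure_integrable_cst mu a).
by rewrite Rintegral_cst //= probability_setT mulr1.
Qed.

Lemma integral_is_indic B : measurable B -> integral_is (\1_B) (fine (mu B)).
Proof.
move=> mB; split; first exact: (integrable_indic mu mB).
by rewrite /Rintegral integral_indic // setIT.
Qed.

Lemma integral_is_sum I (r : seq I) (F : I -> X -> R) v :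
  (forall i, integral_is (F i) (v i)) ->
  integral_is (fun x => \sum_(i <- r) F i x) (\sum_(i <- r) v i).
Proof.
move=> h; elim: r => [|i r IH].
  rewrite big_nil (_ : (fun _ => _) = fun=> 0); first exact: integral_is_cst.
  by apply/funext => x; rewrite big_nil.
rewrite big_cons (_ : (fun _ => _) = fun x => F i x + \sum_(j <- r) F j x).
  exact: integral_isD.
by apply/funext => x; rewrite big_cons.
Qed.

Variable A : set X.
Hypothesis mA : measurable A.

Definition correlation (m : int) : R :=
  fine (mu (A `&` iterz T Tinv m @^-1` A)) - fine (mu A) ^+ 2.

(** By invariance, [correlation (a - b)] is the covariance of the indicators of two translates of
    [A], so the form is the integral of the square of a combination of centred indicators. *)
Lemma posdef_correlation : posdef correlation.
Proof.
pose B m := iterz T Tinv m @^-1` A.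
have mB m : measurable (B m) by apply: measurable_preimage; [exact: measurable_iterz|].
have corrE a b : correlation (a - b) = fine (mu (B a `&` B b)) - fine (mu A) ^+ 2.
  rewrite /correlation -(preserving_iterz b); last by apply: measurableI => //; exact: mB.
  congr (fine (mu _) - _); apply/seteqP; split => x /=.
    by rewrite -(iterz_add (mps_cancel hT) (mps_cancel_inv hT)) subrK => -[].
  by rewrite -(iterz_add (mps_cancel hT) (mps_cancel_inv hT)) subrK => -[].
split=> [x|s].
  by rewrite -[- x]sub0r corrE -[x in RHS]subr0 corrE setIC.
pose a := fine (mu A).
have ev m : integral_is (\1_(B m)) a.
  by have := integral_is_indic (mB m); rewrite preserving_iterz.
have evp (p r : R * int) : integral_is
    (fun x => p.1 * r.1 * (\1_(B p.2 `&` B r.2) x +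
       (- a * \1_(B p.2) x + (- a * \1_(B r.2) x + a ^+ 2))))
    (p.1 * r.1 * correlation (p.2 - r.2)).
  have -> : correlation (p.2 - r.2) =
      fine (mu (B p.2 `&` B r.2)) + (- a * a + (- a * a + a ^+ 2)) by rewrite corrE -/a; ring.
  apply/integral_isZ/integral_isD; first exact/integral_is_indic/measurableI.
  by do 2![apply: integral_isD; first exact: integral_isZ]; exact: integral_is_cst.
rewrite /pd_form; have [_ <-] := integral_is_sum s (fun p => integral_is_sum s (evp p)).
apply: Rintegral_ge0 => x _.
apply: le_trans (sqr_ge0 (\sum_(p <- s) p.1 * (\1_(B p.2) x - a))) _.
rewrite le_eqVlt; apply/orP; left; apply/eqP.
rewrite expr2 mulr_suml; apply: eq_bigr => p _; rewrite mulr_sumr; apply: eq_bigr => r _.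
by rewrite indicI /=; ring.
Qed.

Lemma correlation0_le1 : correlation 0 <= 1.
Proof.
rewrite /correlation (_ : A `&` _ = A); last by apply/seteqP; split => x // [].
have := probability_le1 mu mA; have : (0 <= mu A)%E by [].
rewrite -(@fineK _ (mu A)) ?fin_num_measure // !lee_fin.
by have := sqr_ge0 (fine (mu A)); lra.
Qed.

End Correlation.

(** * Return times meet every [is_Delta0] set up to density 0 *)

Lemma Dset_subseq l r (n : 'I_r -> int) x : subseq x [seq n j | j <- enum 'I_r] ->
  size x = (2 ^ l)%N -> Dset l n (partial l x).
Proof.
move=> /subseqP[m _ ->]; rewrite -map_mask size_map => szx.
exists (tcast szx (in_tuple (mask m (enum 'I_r)))); last by rewrite val_tcast.
rewrite /= val_tcast /= map_mask val_enum_ord.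
exact: (subseq_sorted ltn_trans (mask_subseq _ _) (iota_ltn_sorted _ _)).
Qed.

Theorem theorem6p4 (R : realType) (d : measure_display) (X : measurableType d)
    (mu : probability X R) (T Tinv : X -> X)
    (hT : invertible_mps mu T Tinv)
    (l : nat) (hl : (0 < l)%N) (a : nat -> R)
    (hv : forall z : int, (odd_poly_of l a).[z%:~R] \is a Num.int)
    (A : set X) (hA : measurable A) (eps : R) (heps : 0 < eps) :
  is_A_Delta0_star R l (return_set mu T Tinv (odd_poly_of l a) A eps).
Proof.
pose w z := Num.floor (odd_poly_of l a).[z%:~R].
have wE z : (w z)%:~R = (odd_poly_of l a).[z%:~R] by rewrite /w floorK.
have [psi [chi [phiE [pd_psi tb_psi] pd_chi chi1 mean0]]] :=
  posdef_decomposition (posdef_correlation hT hA) (correlation0_le1 mu T Tinv hA).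
have [D [D0 [b hb]]] := odd_poly_denominator wE.
(* Half of [eps] is spent on [psi], the other half on [chi]. *)
have e20 : 0 < eps / 2 by rewrite divr_gt0.
have [r hr] := odd_poly_recurrence (pd_qnorm pd_psi) tb_psi hl D0 hb e20.
have returns k : (0 < k)%N -> - eps < correlation mu T Tinv A (w k%:Z) ->
    return_set mu T Tinv (odd_poly_of l a) A eps k.
  move=> k0; rewrite /correlation => lt; split => //.
  rewrite -(@fineK _ (mu A)) ?fin_num_measure //.
  rewrite -(@fineK _ (mu (_ `&` _))) ?fin_num_measure //; last first.
    apply: measurableI => //; apply: measurable_preimage => //.
    exact: measurable_iterz hT _.
  by rewrite -EFin_expe -EFinB lte_fin; move: lt; rewrite /w; lra.
have rsub : return_set mu T Tinv (odd_poly_of l a) A eps `<=` Npos by move=> k [].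
split => //.
have [sz1|sz1] := ltnP 1 (size (odd_poly_of l a)).
(* The exceptional set is where [chi] along the polynomial is not small. *)
- exists [set k | Npos k /\ eps / 2 <= `|chi (w k%:Z)|]; split.
  + by move=> k [].
  + apply: (@upper_banach_density0 _ (fun n => `|chi (w n%:Z)|) (eps / 2)) => //.
      by move=> n; rewrite inE => -[].
    apply/unif_null_norm/unif_null_poly => //.
    exact: (nonconst_polyP sz1 (fun n => wE n%:Z)).
  split; first by move=> k [/rsub|[]].
  (* The maximum serves both the Ramsey bound [r] and the minimal length [2 ^ l]. *)
  move=> F [FN hF]; have [F' [F'N [n hn]] F'F] := hF _ (leq_maxr r (2 ^ l)).
  have [|x [subx szx hx]] := hr [seq n j | j <- enum 'I_(maxn r (2 ^ l))].
    by rewrite size_map size_enum_ord leq_maxl.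
  have [k F'k kE] := hn _ (Dset_subseq subx szx).
  exists k; split; last exact: F'F.
  rewrite -kE in hx; have k0 : (0 < k)%N := F'N k F'k.
  have [le|lt] := leP (eps / 2) `|chi (w k%:Z)|; first by right.
  left; apply: returns => //; rewrite phiE.
  have := pd0_ge0 pd_psi; move: lt hx; rewrite ltr_norml => /andP[]; lra.
(* A constant odd polynomial vanishes, so every positive integer is a return time. *)
exists set0; split => //.
  by apply: (@upper_banach_density0 _ (fun=> 0) 1) => // [n|]; rewrite ?inE //;
    move=> e e0; exists 0%N => M n _; rewrite big1 // mulr_ge0 // ltW.
rewrite setU0; split => // F [FN hF]; have [F' [F'N [n hn]] F'F] := hF _ (leq_maxr r (2 ^ l)).
have [|x [subx szx _]] := hr [seq n j | j <- enum 'I_(maxn r (2 ^ l))].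
  by rewrite size_map size_enum_ord leq_maxl.
have [k F'k _] := hn _ (Dset_subseq subx szx).
have k0 : (0 < k)%N := F'N k F'k.
exists k; split; last exact: F'F.
apply: returns => //.
have -> : w k%:Z = 0.
  apply: (intr_inj (R := R)); rewrite wE (size1_polyC sz1) hornerC.
  rewrite -horner_coef0 odd_poly_horner big_nat big1 // => j /andP[j1 _].
  by rewrite expr0n (_ : _ == _ = false) ?mulr0 //; lia.
apply: lt_le_trans (pd0_ge0 (posdef_correlation hT hA)).
by rewrite oppr_lt0.
Qed.
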